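(* Let $\mathcal{L}_{\mathrm{bHAE}}=\mathcal{L}_{\mathrm{bHAE}}(\mathcal{F},\mathcal{G})$ be an arbitrary normal bi-Heyting algebra expansion (bHAE) signature and $\mathcal{L}^\circ_{\mathrm{BAE}}$ its target language. The canonicity theorem for inductive $\mathcal{L}^\circ_{\mathrm{BAE}}$-inequalities transfers to inductive $\mathcal{L}_{\mathrm{bHAE}}$-inequalities; that is: if for every inductive $\mathcal{L}^\circ_{\mathrm{BAE}}$-inequality $\alpha\leq\beta$ and every $\mathcal{L}^\circ_{\mathrm{BAE}}$-algebra $\mathbb{B}$, $\mathbb{B}\models\alpha\leq\beta$ implies $\mathbb{B}^\delta\models\alpha\leq\beta$, then for every inductive $\mathcal{L}_{\mathrm{bHAE}}$-inequality $\varphi\leq\psi$ and every $\mathcal{L}_{\mathrm{bHAE}}$-algebra $\mathbb{A}$, $\mathbb{A}\models\varphi\leq\psi$ implies $\mathbb{A}^\delta\models\varphi\leq\psi$.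
   Context: **Languages.** An order-type over $n$ is an element of $\{1,\partial\}^n$; $\varepsilon^\partial$ is the opposite order-type. $X=\mathsf{Prop}$ is a denumerable set of variables; $\mathcal{F},\mathcal{G}$ are disjoint sets of connectives, each $h$ with arity $n_h$ and order-type $\varepsilon_h$ over $n_h$. $\mathcal{L}_{\mathrm{bHAE}}$-formulas: $\varphi::=p\mid\bot\mid\top\mid\varphi\wedge\varphi\mid\varphi\vee\varphi\mid\varphi\to\varphi\mid\varphi>\!\!-\,\varphi\mid f(\overline{\varphi})\mid g(\overline{\varphi})$. For classifying nodes, $\to$ is counted as a binary $g$-type connective and $>\!\!-$ as a binary $f$-type connective, both of order-type $(\partial,1)$. $\mathcal{L}^\circ_{\mathrm{BAE}}$-formulas: $\alpha::=p\mid\bot\mid\alpha\vee\alpha\mid\alpha\wedge\alpha\mid\neg\alpha\mid f^\circ(\overline{\alpha})\mid g^\circ(\overline{\alpha})\mid\Diamond_\geq\alpha\mid\Box_\leq\alpha$, with one $f^\circ$ ($g^\circ$) for each $f\in\mathcal{F}$ ($g\in\mathcal{G}$), of the same arity and order-type constantly $1$ ($\top:=\neg\bot$). **Algebras.** An $\mathcal{L}_{\mathrm{bHAE}}$-algebra is a bi-Heyting algebra (bounded distributive lattice with $a\wedge b\leq d$ iff $b\leq a\to d$, and $a>\!\!-\,b\leq d$ iff $b\leq a\vee d$) with operations $f^{\mathbb{A}},g^{\mathbb{A}}$ that are normal: each $f^{\mathbb{A}}$ preserves finite (also empty) joins in coordinates with $\varepsilon_f(i)=1$ and turns finite (also empty)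 meets into joins in coordinates with $\varepsilon_f(i)=\partial$; each $g^{\mathbb{A}}$ preserves finite meets in coordinates with $\varepsilon_g(i)=1$ and turns finite joins into meets in coordinates with $\varepsilon_g(i)=\partial$. An $\mathcal{L}^\circ_{\mathrm{BAE}}$-algebra is a Boolean algebra with operations $f^\circ,\Diamond_\geq$ preserving finite (also empty) joins in each coordinate and $g^\circ,\Box_\leq$ preserving finite (also empty) meets in each coordinate. $\mathbb{A}\models\varphi\leq\psi$ means that $\varphi\leq\psi$ holds in $\mathbb{A}$ under every assignment of elements of $\mathbb{A}$ to variables. **Canonical extensions.** The canonical extension $L^\delta$ of a bounded lattice $L$ is the (unique up to isomorphism) complete lattice containing $L$ as a sublattice such that every element is both a join of meets and a meet of joins of elements of $L$, and for all $S,T\subseteq L$ with $\bigwedge S\leq\bigvee T$ there are finite $S'\subseteq S$, $T'\subseteq T$ with $\bigwedge S'\leq\bigvee T'$. Closed (open) elements are meets (joins) of subsets of $L$; their sets are $K(L^\delta)$, $O(L^\delta)$. For order-preserving $h\colon L\to M$: $h^\sigma(k)=\bigwedge\{h(a)\mid a\in L,k\leq a\}$ for $k\in K(L^\delta)$, $h^\sigma(u)=\bigvee\{h^\sigma(k)\mid k\in K(L^\delta),k\leq u\}$; dually $h^\pi(o)=\bigvee\{h(a)\mid a\in L,a\leq o\}$ for $o\in O(L^\delta)$, $h^\pi(u)=\bigwedge\{h^\pi(o)\mid o\in O(L^\delta),u\leq o\}$. For operations of order-type $\varepsilon$ these are applied to $h\colon L^\varepsilon\to L$, with $L^\varepsilon=\prod_iL^{\varepsilon(i)}$,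 $L^1=L$, $L^\partial$ the order-dual, and $(L^\varepsilon)^\delta=(L^\delta)^\varepsilon$. $\mathbb{A}^\delta$ is $L^\delta$ with $f$-type operations (including $>\!\!-$, $\Diamond_\geq$, $f^\circ$) extended by $\sigma$ and $g$-type operations (including $\to$, $\Box_\leq$, $g^\circ$) extended by $\pi$. **Inductive inequalities** (for $\mathcal{L}_{\mathrm{bHAE}}$, and for $\mathcal{L}^\circ_{\mathrm{BAE}}$ with $f$-type connectives $\Diamond_\geq,f^\circ$, $g$-type connectives $\Box_\leq,g^\circ$, and $\neg$ counted both as a unary $f$-type and as a unary $g$-type connective of order-type $\partial$). The signed generation tree $+s$ ($-s$) of a term $s$ is its syntax tree with the root signed $+$ ($-$); children of $\vee,\wedge$ inherit the sign; the $i$th child of $h$ gets the same sign if $\varepsilon_h(i)=1$ and the opposite sign if $\varepsilon_h(i)=\partial$. Skeleton nodes: $\Delta$-adjoints ($+\vee,+\wedge,-\wedge,-\vee$) and SLR nodes ($+\wedge$; $+f$ with $n_f\geq1$; $-\vee$; $-g$ with $n_g\geq1$). PIA nodes: SRA nodes ($+\wedge$; $+g$ with $n_g=1$; $-\vee$; $-f$ with $n_f=1$) and SRR nodes ($+\vee$; $+g$ with $n_g\geq2$; $-\wedge$; $-f$ with $n_f\geq2$). For an order-type $\varepsilon$ on the variables, a leaf $+p$ with $\varepsilon(p)=1$ or $-p$ with $\varepsilon(p)=\partial$ is $\varepsilon$-critical; an $\varepsilon$-critical branch is a branch from an $\varepsilon$-critical leaf to the root. A branch is good if it is the concatenation of two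 paths $P_1,P_2$ (one possibly of length $0$), $P_1$ starting at the leaf and consisting, apart from variable nodes, only of PIA nodes, and $P_2$ consisting, apart from variable nodes, only of Skeleton nodes. Given an irreflexive transitive relation $<_\Omega$ on the variables $p_1,\dots,p_n$, the signed tree $*s$ is $(\Omega,\varepsilon)$-inductive if (1) every $\varepsilon$-critical branch is good, and (2) every $m$-ary SRR node occurring in an $\varepsilon$-critical branch with leaf $p_i$ is of the form $\circledast(\gamma_1,\dots,\gamma_{j-1},\beta,\gamma_{j+1},\dots,\gamma_m)$ (the branch passing through $\beta$), where for every $h\neq j$: (a) every variable leaf of $\gamma_h$, with the sign inherited from $*s$, is $\varepsilon^\partial$-critical, and (b) $p_k<_\Omega p_i$ for every $p_k$ occurring in $\gamma_h$. An inequality $s\leq t$ is $(\Omega,\varepsilon)$-inductive if $+s$ and $-t$ are; it is inductive if it is $(\Omega,\varepsilon)$-inductive for some $<_\Omega$ and $\varepsilon$. *)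

(* Defs.v *)
From mathcomp Require Import all_boot all_order.
From mathcomp Require Import boolp classical_sets.

Set Implicit Arguments.
Unset Strict Implicit.
Unset Printing Implicit Defensive.

Import Order.TTheory.
Local Open Scope order_scope.

(* In order-types, true stands for 1 and false for the opposite order; in signs,
   true stands for + and false for -. *)

(** * Languages *)

(* Lattice-based languages.  A connective may be both f-type and g-type (Boolean
   negation).  The constant top is primitive only if has_top holds. *)
Record lang := Lang {
  conn : Type;
  arity : conn -> nat;
  otype : forall c : conn, 'I_(arity c) -> bool;
  ftype : conn -> bool;
  gtype : conn -> bool;
  has_top : bool }.

Inductive term (S : lang) : Type :=
  | Var of nat
  | Bot
  | Top of has_top S
  | And of term S & term S
  | Or of term S & term S
  | Op (c : conn S) of 'I_(arity c) -> term S.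

Arguments Var {S}.
Arguments Bot {S}.
Arguments Top {S}.
Arguments Op {S}.

Record bhae_sig := BhaeSig {
  fconn : Type;
  gconn : Type;
  far : fconn -> nat;
  gar : gconn -> nat;
  fot : forall f : fconn, 'I_(far f) -> bool;
  got : forall g : gconn, 'I_(gar g) -> bool }.

Variant bhae_conn (S : bhae_sig) :=
  Imp | Coimp | Fc of fconn S | Gc of gconn S.

Arguments Imp {S}.
Arguments Coimp {S}.

Definition bhae_arity (S : bhae_sig) (c : bhae_conn S) : nat :=
  match c with Imp | Coimp => 2 | Fc f => far f | Gc g => gar g end.

Definition bhae_otype (S : bhae_sig) (c : bhae_conn S) :
    'I_(bhae_arity c) -> bool :=
  match c with
  | Imp | Coimp => fun i => i == 1 :> nat
  | Fc f => @fot S f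
  | Gc g => @got S g
  end.

Definition bhae (S : bhae_sig) : lang :=
  {| conn := bhae_conn S;
     arity := @bhae_arity S;
     otype := @bhae_otype S;
     ftype := fun c => if c is (Coimp | Fc _) then true else false;
     gtype := fun c => if c is (Imp | Gc _) then true else false;
     has_top := true |}.

Variant bae_conn (S : bhae_sig) :=
  Neg | DiaGe | BoxLe | Fo of fconn S | Go of gconn S.

Arguments Neg {S}.
Arguments DiaGe {S}.
Arguments BoxLe {S}.

Definition bae_arity (S : bhae_sig) (c : bae_conn S) : nat :=
  match c with Neg | DiaGe | BoxLe => 1 | Fo f => far f | Go g => gar g end.

Definition bae (S : bhae_sig) : lang :=
  {| conn := bae_conn S;
     arity := @bae_arity S;
     otype := fun c _ => if c is Neg then false else true;
     ftype := fun c => if c is (Neg | DiaGe | Fo _) then true else false;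
     gtype := fun c => if c is (Neg | BoxLe | Go _) then true else false;
     has_top := false |}.

(** * Algebras *)

Definition ops (S : lang) (T : Type) :=
  forall c : conn S, ('I_(arity c) -> T) -> T.

Fixpoint eval (S : lang) d (L : tbLatticeType d) (op : ops S L)
    (v : nat -> L) (t : term S) : L :=
  match t with
  | Var p => v p
  | Bot => \bot
  | Top _ => \top
  | And s t => eval op v s `&` eval op v t
  | Or s t => eval op v s `|` eval op v t
  | Op c u => op c (fun i => eval op v (u i))
  end.

Definition valid (S : lang) d (L : tbLatticeType d) (op : ops S L)
    (s t : term S) : Prop :=
  forall v : nat -> L, eval op v s <= eval op v t.

Section Normality.
Variables (d : Order.disp_t) (L : tbLatticeType d) (n : nat).
Variables (eps : 'I_n -> bool) (h : ('I_n -> L) -> L).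

Definition f_normal : Prop :=
  forall (u : 'I_n -> L) (i : 'I_n) (s : seq L),
    if eps i then
      h [eta u with i |-> \join_(x <- s) x] = \join_(x <- s) h [eta u with i |-> x]
    else
      h [eta u with i |-> \meet_(x <- s) x] = \join_(x <- s) h [eta u with i |-> x].

Definition g_normal : Prop :=
  forall (u : 'I_n -> L) (i : 'I_n) (s : seq L),
    if eps i then
      h [eta u with i |-> \meet_(x <- s) x] = \meet_(x <- s) h [eta u with i |-> x]
    else
      h [eta u with i |-> \join_(x <- s) x] = \meet_(x <- s) h [eta u with i |-> x].

End Normality.

Definition pair2 (T : Type) (a b : T) : 'I_2 -> T :=
  fun i => if i == 0 :> nat then a else b.

Record bhae_algebra (S : bhae_sig) d (A : tbDistrLatticeType d)
    (op : ops (bhae S) A) : Prop := BhaeAlgebra {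
  imp_residual : forall a b x : A, (a `&` b <= x) = (b <= op Imp (pair2 a x));
  coimp_residual : forall a b x : A, (op Coimp (pair2 a b) <= x) = (b <= a `|` x);
  bhae_f_normal : forall f : fconn S, f_normal (@fot S f) (op (Fc f));
  bhae_g_normal : forall g : gconn S, g_normal (@got S g) (op (Gc g)) }.

Record bae_algebra (S : bhae_sig) d (B : ctbDistrLatticeType d)
    (op : ops (bae S) B) : Prop := BaeAlgebra {
  neg_compl : forall u : 'I_1 -> B, op Neg u = ~` (u ord0);
  dia_normal : f_normal (fun=> true) (op DiaGe);
  box_normal : g_normal (fun=> true) (op BoxLe);
  bae_f_normal : forall f : fconn S, f_normal (fun=> true) (op (Fo f));
  bae_g_normal : forall g : gconn S, g_normal (fun=> true) (op (Go g)) }.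

(** * Canonical extensions *)

Section CanonicalExtension.
Context {d d' : Order.disp_t} {L : tbLatticeType d} {C : tbLatticeType d'}.
Variable e : {lmorphism L -> C}.
Local Open Scope classical_set_scope.

Definition closed_elt : set C :=
  [set k | exists S : set L, infimums (e @` S) k].

Definition open_elt : set C :=
  [set o | exists S : set L, supremums (e @` S) o].

(* {tblmorphism L -> C} requires only the preservation of the bounds, hence the
   lattice morphism and the two separate conditions on bounds. *)
Record canonical_extension : Prop := CanonicalExtension {
  ce_inj : injective e;
  ce_bot : e \bot%O = \bot%O;
  ce_top : e \top%O = \top%O;
  ce_sup : forall S : set C, supremums S !=set0;
  ce_inf : forall S : set C, infimums S !=set0;
  ce_join_meets : forall u : C,
    exists2 S : set C, S `<=` closed_elt & supremums S u;
  ce_meet_joins : forall u : C,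
    exists2 S : set C, S `<=` open_elt & infimums S u;
  ce_compact : forall (S T : set L) (k o : C),
    infimums (e @` S) k -> supremums (e @` T) o -> (k <= o)%O ->
    exists s t : seq L,
      [/\ [set` s] `<=` S, [set` t] `<=` T &
          (\meet_(x <- s) x <= \join_(x <- t) x)%O] }.

(* supremum x0 S is x0 if S is empty. *)
Definition Join (S : set C) : C := supremum \bot%O S.
Definition Meet (S : set C) : C := infimum \top%O S.

Section Extensions.
Variables (n : nat) (eps : 'I_n -> bool) (h : ('I_n -> L) -> L).

(* The order, the meets and the joins of C^eps; the order of C is reversed in the
   coordinates i with eps i = false. *)
Definition eps_le (u v : 'I_n -> C) : Prop :=
  forall i, if eps i then (u i <= v i)%O else (v i <= u i)%O.

Definition eps_infimums (S : set ('I_n -> C)) : set ('I_n -> C) :=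
  [set u | forall i,
     if eps i then infimums [set a i | a in S] (u i)
     else supremums [set a i | a in S] (u i)].

Definition eps_supremums (S : set ('I_n -> C)) : set ('I_n -> C) :=
  [set u | forall i,
     if eps i then supremums [set a i | a in S] (u i)
     else infimums [set a i | a in S] (u i)].

Definition eps_closed : set ('I_n -> C) :=
  [set k | exists S : set ('I_n -> L), eps_infimums [set e \o a | a in S] k].

Definition eps_open : set ('I_n -> C) :=
  [set o | exists S : set ('I_n -> L), eps_supremums [set e \o a | a in S] o].

Definition sigma_closed (k : 'I_n -> C) : C :=
  Meet [set e (h a) | a in [set a | eps_le k (e \o a)]].

Definition sigma_ext (u : 'I_n -> C) : C :=
  Join [set sigma_closed k | k in [set k | eps_closed k /\ eps_le k u]].

Definition pi_open (o : 'I_n -> C) : C :=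
  Join [set e (h a) | a in [set a | eps_le (e \o a) o]].

Definition pi_ext (u : 'I_n -> C) : C :=
  Meet [set pi_open o | o in [set o | eps_open o /\ eps_le u o]].

End Extensions.

(* The only connective that is both f-type and g-type is Boolean negation, whose
   sigma- and pi-extension coincide. *)
Definition delta_ops (S : lang) (op : ops S L) : ops S C := fun c =>
  if ftype c then sigma_ext (@otype S c) (op c)
  else pi_ext (@otype S c) (op c).

End CanonicalExtension.

(** * Inductive inequalities *)

Section Inductive.
Variable S : lang.

(* A node of a signed generation tree, given by its sign and its subtree. *)
Definition snode : Type := (bool * term S)%type.

Definition node_arity (x : snode) : nat :=
  match x.2 with And _ _ | Or _ _ => 2 | Op c _ => arity c | _ => 0 end.

Definition node_child (x : snode) : 'I_(node_arity x) -> snode :=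
  let: (b, t) := x in
  match t return 'I_(node_arity (b, t)) -> snode with
  | And s1 s2 | Or s1 s2 => fun i => (b, pair2 s1 s2 i)
  | Op c u => fun i => (if otype i then b else ~~ b, u i)
  | _ => fun=> x
  end.

Definition delta_adjoint (x : snode) : bool :=
  match x.2 with And _ _ | Or _ _ => true | _ => false end.

Definition slr (x : snode) : bool :=
  match x with
  | (true, And _ _) | (false, Or _ _) => true
  | (true, Op c _) => ftype c && (1 <= arity c)%N
  | (false, Op c _) => gtype c && (1 <= arity c)%N
  | _ => false
  end.

Definition sra (x : snode) : bool :=
  match x with
  | (true, And _ _) | (false, Or _ _) => true
  | (true, Op c _) => gtype c && (arity c == 1)
  | (false, Op c _) => ftype c && (arity c == 1)
  | _ => false
  end.

Definition srr (x : snode) : bool :=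
  match x with
  | (true, Or _ _) | (false, And _ _) => true
  | (true, Op c _) => gtype c && (2 <= arity c)%N
  | (false, Op c _) => ftype c && (2 <= arity c)%N
  | _ => false
  end.

Definition skeleton (x : snode) : bool := delta_adjoint x || slr x.
Definition pia (x : snode) : bool := sra x || srr x.

(* An inner node on a branch, with the child through which the branch passes. *)
Record step := Step { node : snode; dir : 'I_(node_arity node) }.

(* l lists the inner nodes of a branch of x, from the root to the leaf labelled
   with the variable lf.2 signed lf.1. *)
Fixpoint branch (x : snode) (l : seq step) (lf : bool * nat) : Prop :=
  match l with
  | [::] => x = (lf.1, Var lf.2)
  | st :: l' => node st = x /\ branch (node_child (dir st)) l' lf
  end.

Definition leaf_of (x : snode) (lf : bool * nat) : Prop :=
  exists l, branch x l lf.

Definition critical (eps : nat -> bool) (lf : bool * nat) : bool :=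
  lf.1 == eps lf.2.

Definition good (l : seq step) : Prop :=
  exists P2 P1 : seq step,
    [/\ l = P2 ++ P1, all (fun st => pia (node st)) P1 &
        all (fun st => skeleton (node st)) P2].

(* srr_siblings applies to every signed node of one of the SRR shapes, so also to
   nodes +Or and -And that belong to the skeleton part of a good branch. *)
Record inductive_tree (Omega : rel nat) (eps : nat -> bool) (x : snode) : Prop :=
  InductiveTree {
  critical_good : forall l lf, branch x l lf -> critical eps lf -> good l;
  srr_siblings : forall l1 st l2 lf,
    branch x (l1 ++ st :: l2) lf -> critical eps lf -> srr (node st) ->
    forall h : 'I_(node_arity (node st)), h != dir st ->
    forall lf', leaf_of (node_child h) lf' ->
      critical (fun p => ~~ eps p) lf' /\ Omega lf'.2 lf.2 }.

Definition inductive_ineq (s t : term S) : Prop :=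
  exists (Omega : rel nat) (eps : nat -> bool),
    [/\ irreflexive Omega, transitive Omega,
        inductive_tree Omega eps (true, s) & inductive_tree Omega eps (false, t)].

End Inductive.

(* Main.v *)
Require Import Defs.
From HB Require Import structures.
From mathcomp Require Import all_boot all_order.
From mathcomp Require Import boolp classical_sets.

Set Implicit Arguments.
Unset Strict Implicit.
Unset Printing Implicit Defensive.

Import Order.TTheory Order.CTheory.

(** The idea is to recognize inductive inequalities over A as inductive
    inequalities over a Boolean algebra B that contains A, in a way that is
    compatible with canonical extensions on both sides.

    Let X be the set of prime filters of A and let B be the Boolean algebra of
    the clopen sets of the patch topology of X, that is, the free Boolean
    extension of A, with A embedded by a |-> hat a = {x | a \in x}.  By
    compactness each member of B is a finite join of sets hat a \ hat b, so the
    two residuals of A provide a left adjoint (lower) and a right adjoint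
    (upper) of hat.  The diamond of B is hat o lower, and its box is
    hat o upper.  The operator of B for f sends (U_i) to hat f(a_i), where a_i is lower U_i
    in the positive coordinates and upper (~ U_i) in the negative ones, and
    dually for g; these are normal (booleanization_bae_algebra).

    For an order-type eps on the variables, the translation puts a box on p if
    eps p = 1 and a diamond otherwise, sends a -> b to box (~ a \/ b) and
    a >- b to diamond (~ a /\ b), and negates the negative coordinates
    of f and g.  It keeps the signed variable leaves, it turns PIA nodes into
    paths of PIA nodes and Skeleton nodes into paths of Skeleton nodes, and it
    creates an SRR node only from an SRR node with the same siblings; the new
    nodes above a critical leaf are PIA.  Hence it preserves (Omega,eps)-
    inductivity (inductive_translate).  Its value in B is the image under hat of
    a value of the original term in A (eval_translate), so it transports
    validity from A to B, and the assumed canonicity applies to B.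

    The canonical extension of B is the powerset of X
    (booleanization_canonical_extension).  In a canonical extension of A, the
    meet of the elements of a prime filter x lies below u or else u lies below
    the join of the elements outside x; so u |-> extent u = {x | the meet of x
    is below u} is an order embedding into the powerset of X that respects all
    joins and meets.  It takes the extended operations of A to those of B:
    extent_sigma and extent_pi for f and g, and, for the residuals, extent_imp
    and extent_coimp together with the relational description of the extended
    modalities (pi_box, sigma_dia).  Both sides of the transfer for f and g
    quantify over closed elements, and a closed set K of the powerset has as its
    best approximations in the canonical extension of A the meet of the elements
    lower U and the join of the elements upper (~ U), where U ranges over the
    members of B that contain K; that these describe the points above and below
    K is a compactness argument (closed_lower, closed_upper).  Therefore the
    translated term takes the value extent of the original one
    (eval_translate_delta), and the inequality that holds in the powerset is
    reflected to the canonical extension of A. *)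

(** * Signed branches of terms *)

Section Branches.
Variable S : lang.
Implicit Types (x : snode S) (lf : bool * nat).

Lemma branch_cons x st l lf :
  branch x (st :: l) lf <->
  exists2 i, st = @Step S x i & branch (node_child i) l lf.
Proof.
split=> [[]|[i ->]] //; case: st => y i /= E; case: x / E => H.
by exists i.
Qed.

Lemma leaf_ofE x lf :
  leaf_of x lf <->
  x = (lf.1, Var lf.2) \/ exists i, leaf_of (@node_child S x i) lf.
Proof.
split=> [[[|st l]]|[xE|[i [l xl]]]].
- by left.
- by move=> /branch_cons[i _ il]; right; exists i, l.
- by exists [::].
- by exists (Step i :: l); apply/branch_cons; exists i.
Qed.

Variables (Omega : rel nat) (eps : nat -> bool).

Definition has_critical x := exists2 lf, leaf_of x lf & critical eps lf.

(** Inductivity speaks of whole branches.  The predicates all_pia, all_good and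
    siblings split it into parts that can be read off a node and its children
    (all_piaE, all_goodE, siblingsE), as an induction on terms requires. *)
Definition all_pia x := forall l lf,
  branch x l lf -> critical eps lf -> all (fun st => pia (node st)) l.

Definition all_good x := forall l lf,
  branch x l lf -> critical eps lf -> good l.

Definition siblings x := forall l1 st l2 lf,
  branch x (l1 ++ st :: l2) lf -> critical eps lf -> srr (node st) ->
  forall h : 'I_(node_arity (node st)), h != dir st ->
  forall lf', leaf_of (node_child h) lf' ->
    critical (fun p => ~~ eps p) lf' /\ Omega lf'.2 lf.2.

Lemma inductive_treeE x :
  inductive_tree Omega eps x <-> all_good x /\ siblings x.
Proof. by split=> [[]|[]]; split. Qed.

Lemma all_piaE x :
  all_pia x <-> forall i, all_pia (@node_child S x i) /\
                          (has_critical (node_child i) -> pia x).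
Proof.
split=> [xP i|xP [|st l] lf //].
  have xiP l lf : branch (node_child i) l lf -> critical eps lf ->
      pia x && all (fun st => pia (node st)) l.
    by move=> il; apply: (xP (Step i :: l)); apply/branch_cons; exists i.
  by split=> [l lf /xiP/[apply]/andP[]|[lf [l /xiP/[apply]/andP[]]]].
move=> /branch_cons[i -> il] c /=; have [iP pP] := xP i.
by rewrite (iP _ _ il c) pP //; exists lf => //; exists l.
Qed.

Lemma all_pia_node x :
  pia x -> (forall i, all_pia (@node_child S x i)) -> all_pia x.
Proof. by move=> xP cP; apply/all_piaE. Qed.

Lemma good_cons (st : step S) l :
  good (st :: l) <->
  all (fun s => pia (node s)) (st :: l) \/ skeleton (node st) /\ good l.
Proof.
split=> [[[|s P2] [P1 [/= E a1 a2]]]|[al|[sk [P2 [P1 [-> a1 a2]]]]]].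
- by left; move: a1; rewrite -E.
- by right; case: E a2 => -> -> /andP[-> a2]; split=> //; exists P2, P1.
- by exists [::], (st :: l).
- by exists (st :: P2), P1; rewrite /= sk a2.
Qed.

Lemma all_pia_good x : all_pia x -> all_good x.
Proof. by move=> xP l lf xl /(xP _ _ xl) a; exists [::], l. Qed.

(** A node that is not Skeleton ends the Skeleton part of every branch through
    it, so all that lies below it on a critical branch is PIA.  Below a Skeleton
    node a branch that is PIA up to the root is good as well, which is why the
    first case needs no alternative. *)
Lemma all_goodE x :
  all_good x <-> if skeleton x then forall i, all_good (@node_child S x i)
                 else all_pia x.
Proof.
case: ifPn => sx; split.
- move=> xG i l lf il c.
  have il' : branch x (Step i :: l) lf by apply/branch_cons; exists i.
  have /good_cons[/andP[_ al]|[]//] := xG _ _ il' c.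
  by exists [::], l.
- move=> xG [|st l] lf; first by exists [::], [::].
  by move=> /branch_cons[i -> /xG/[apply] ?]; apply/good_cons; right.
- move=> xG [|st l] lf // xl /(xG _ _ xl)/good_cons[//|[]].
  by move/branch_cons: xl => [i -> _]; rewrite (negPf sx).
- exact: all_pia_good.
Qed.

Lemma all_good_node x :
  skeleton x -> (forall i, all_good (@node_child S x i)) -> all_good x.
Proof. by move=> xsk cG; apply/all_goodE; rewrite xsk. Qed.

Lemma siblingsE x :
  siblings x <->
  (forall i, siblings (@node_child S x i)) /\
  (srr x -> forall i h lf lf', h != i -> leaf_of (@node_child S x i) lf ->
     critical eps lf -> leaf_of (@node_child S x h) lf' ->
     critical (fun p => ~~ eps p) lf' /\ Omega lf'.2 lf.2).
Proof.
split=> [xS|[cS xS] [|st0 l1] st l2 lf].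
- split=> [i l1 st l2 lf il|sx i h lf lf' hi [l il] c].
    by apply: (xS (Step i :: l1) st l2 lf); apply/branch_cons; exists i.
  by apply: (xS [::] (Step i) l lf) => //; apply/branch_cons; exists i.
- move=> /branch_cons[i -> il] c sx h hi lf'.
  by apply: (xS sx i) => //; exists l2.
- by move=> /branch_cons[i _ /cS].
Qed.

Lemma siblings_node x :
  ~~ srr x -> (forall i, siblings (@node_child S x i)) -> siblings x.
Proof. by move=> /negPf xN cS; apply/siblingsE; rewrite xN. Qed.

Lemma all_pia_noncritical x : ~ has_critical x -> all_pia x.
Proof. by move=> xN l lf xl c; case: xN; exists lf => //; exists l. Qed.

End Branches.

(** * The parametrized Goedel-McKinsey-Tarski translation *)

Section Translation.
Variables (S : bhae_sig) (eps : nat -> bool).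

Definition neg (t : term (bae S)) : term (bae S) :=
  @Op (bae S) Neg (fun=> t).
Definition box (t : term (bae S)) : term (bae S) :=
  @Op (bae S) BoxLe (fun=> t).
Definition dia (t : term (bae S)) : term (bae S) :=
  @Op (bae S) DiaGe (fun=> t).

(** No modality is put in front of the operators for f and g: on the Boolean
    algebra that is built over A, their values come from A already. *)
Definition translate_op (c : conn (bhae S)) :
    ('I_(arity c) -> term (bae S)) -> term (bae S) :=
  match c return ('I_(@arity (bhae S) c) -> term (bae S)) -> term (bae S) with
  | Imp => fun u => box (Or (neg (u ord0)) (u ord_max))
  | Coimp => fun u => dia (And (neg (u ord0)) (u ord_max))
  | Fc f => fun u => @Op (bae S) (Fo f)
                       (fun i => if fot i then u i else neg (u i))
  | Gc g => fun u => @Op (bae S) (Go g)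
                       (fun i => if got i then u i else neg (u i))
  end.

Fixpoint translate (t : term (bhae S)) : term (bae S) :=
  match t with
  | Var p => if eps p then box (Var p) else dia (Var p)
  | Bot => Bot
  | Top _ => neg Bot
  | And s t => And (translate s) (translate t)
  | Or s t => Or (translate s) (translate t)
  | Op c u => translate_op (fun i => translate (u i))
  end.

Implicit Types (b : bool) (t : term (bae S)) (lf : bool * nat).

Lemma leaf_neg b t lf : leaf_of (b, neg t) lf <-> leaf_of (~~ b, t) lf.
Proof.
split=> [/leaf_ofE[//|[i]]//|?].
by apply/leaf_ofE; right; exists ord0.
Qed.

Lemma leaf_box b t lf : leaf_of (b, box t) lf <-> leaf_of (b, t) lf.
Proof.
split=> [/leaf_ofE[//|[i]]//|?].
by apply/leaf_ofE; right; exists ord0.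
Qed.

Lemma leaf_dia b t lf : leaf_of (b, dia t) lf <-> leaf_of (b, t) lf.
Proof.
split=> [/leaf_ofE[//|[i]]//|?].
by apply/leaf_ofE; right; exists ord0.
Qed.

Lemma ord2P (P : 'I_2 -> Prop) : P ord0 -> P ord_max -> forall i, P i.
Proof.
move=> P0 P1 [[|[|//]] lt]; [rewrite (_ : Ordinal lt = ord0)|
  rewrite (_ : Ordinal lt = ord_max)] => //; exact/val_inj.
Qed.

Lemma leaf_and (L : lang) b (s t : term L) lf :
  leaf_of (b, And s t) lf <-> leaf_of (b, s) lf \/ leaf_of (b, t) lf.
Proof.
split=> [/leaf_ofE[//|[]]|[] ?].
- by apply: ord2P; [left|right].
- by apply/leaf_ofE; right; exists ord0.
- by apply/leaf_ofE; right; exists ord_max.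
Qed.

Lemma leaf_or (L : lang) b (s t : term L) lf :
  leaf_of (b, Or s t) lf <-> leaf_of (b, s) lf \/ leaf_of (b, t) lf.
Proof.
split=> [/leaf_ofE[//|[]]|[] ?].
- by apply: ord2P; [left|right].
- by apply/leaf_ofE; right; exists ord0.
- by apply/leaf_ofE; right; exists ord_max.
Qed.

Lemma leaf_var (L : lang) b p lf : @leaf_of L (b, Var p) lf <-> lf = (b, p).
Proof.
split=> [/leaf_ofE[[-> ->]|[[]//]]|->]; first by case: lf.
by exists [::].
Qed.

Lemma leaf_bot (L : lang) b lf : ~ @leaf_of L (b, Bot) lf.
Proof. by move=> /leaf_ofE[|[[]]]. Qed.

Lemma leaf_top (L : lang) b (h : has_top L) lf : ~ leaf_of (b, Top h) lf.
Proof. by move=> /leaf_ofE[|[[]]]. Qed.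

(** The modalities keep signs, and each new negation sits where the sign was
    flipped before, so the signed leaves do not change. *)
Lemma leaf_translate (s : term (bhae S)) b lf :
  leaf_of (b, translate s) lf <-> leaf_of (b, s) lf.
Proof.
elim: s b => [p||h|s IHs t IHt|s IHs t IHt|[||f|g] u IHu] b.
- by rewrite /=; case: (eps p); rewrite ?leaf_box ?leaf_dia !leaf_var.
- by split=> /leaf_bot.
- by split=> [/leaf_neg/leaf_bot|/leaf_top].
- by rewrite !leaf_and IHs IHt.
- by rewrite !leaf_or IHs IHt.
- rewrite leaf_box leaf_or leaf_neg !IHu.
  rewrite (leaf_ofE (_, Op _ _)); split=> [H|[//|[]]].
    by right; case: H => H; [exists ord0|exists ord_max].
  by apply: ord2P => ?; [left|right].
- rewrite leaf_dia leaf_and leaf_neg !IHu.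
  rewrite (leaf_ofE (_, Op _ _)); split=> [H|[//|[]]].
    by right; case: H => H; [exists ord0|exists ord_max].
  by apply: ord2P => ?; [left|right].
- rewrite !(leaf_ofE (_, Op _ _)); split=> -[//|[i]] /=.
    by case E: (fot i); rewrite ?leaf_neg IHu => ?; right; exists i;
      rewrite /= E.
  case E: (fot i); rewrite -IHu => ?; right; exists i; rewrite /= E //.
  exact/leaf_neg.
- rewrite !(leaf_ofE (_, Op _ _)); split=> -[//|[i]] /=.
    by case E: (got i); rewrite ?leaf_neg IHu => ?; right; exists i;
      rewrite /= E.
  case E: (got i); rewrite -IHu => ?; right; exists i; rewrite /= E //.
  exact/leaf_neg.
Qed.

Lemma critical_translate (s : term (bhae S)) b :
  has_critical eps (b, translate s) <-> has_critical eps (b, s).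
Proof. by split=> -[lf /leaf_translate ? ?]; exists lf. Qed.

Lemma all_pia_var (L : lang) b p : @all_pia L eps (b, Var p).
Proof. by apply/all_piaE => -[]. Qed.

Lemma all_pia_neg b t : all_pia eps (~~ b, t) -> all_pia eps (b, neg t).
Proof. by move=> tP; apply: all_pia_node => //; case: b {tP}. Qed.

Lemma all_pia_and (L : lang) b (s t : term L) :
  all_pia eps (b, And s t) <-> all_pia eps (b, s) /\ all_pia eps (b, t).
Proof.
split=> [/all_piaE stP|[sP tP]].
  by split; [case: (stP ord0)|case: (stP ord_max)].
by apply: all_pia_node; [case: b {sP tP}|apply: ord2P].
Qed.

Lemma all_pia_or (L : lang) b (s t : term L) :
  all_pia eps (b, Or s t) <-> all_pia eps (b, s) /\ all_pia eps (b, t).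
Proof.
split=> [/all_piaE stP|[sP tP]].
  by split; [case: (stP ord0)|case: (stP ord_max)].
by apply: all_pia_node; [case: b {sP tP}|apply: ord2P].
Qed.

(** If no branch is critical the claim is empty, since critical leaves are
    preserved.  Otherwise the root is PIA, which fixes the sign of an implication
    or coimplication and makes the root of the translation PIA.  At a critical
    leaf the order-type selects the modality that is PIA there. *)
Lemma all_pia_translate (s : term (bhae S)) b :
  all_pia eps (b, s) -> all_pia eps (b, translate s).
Proof.
elim: s b => [p||h|s IHs t IHt|s IHs t IHt|c u IHu] b sP.
- have [bp|bp] := eqVneq b (eps p); last first.
    apply: all_pia_noncritical => /critical_translate[lf /leaf_var ->].
    by rewrite /critical (negPf bp).
  by rewrite /= -bp; case: b bp sP => bp _; apply: all_pia_node => // i;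
    apply: all_pia_var.
- by apply: all_pia_noncritical => -[lf /leaf_bot].
- by apply: all_pia_noncritical => -[lf /leaf_neg/leaf_bot].
- by move/all_pia_and: sP => [/IHs sP /IHt tP]; apply/all_pia_and.
- by move/all_pia_or: sP => [/IHs sP /IHt tP]; apply/all_pia_or.
have [[lf leaf c_lf]|] := pselect (has_critical eps (b, Op c u)); last first.
  by move=> N; apply: all_pia_noncritical => /critical_translate.
have {lf leaf c_lf} piau : pia (b, Op c u).
  have /leaf_ofE[//|[i leaf_i]] := leaf.
  by have [_ ->] := (all_piaE eps _).1 sP i => //; exists lf.
have {}sP i : all_pia eps (if otype i then b else ~~ b, u i).
  by have [] := (all_piaE eps _).1 sP i.
case: c u IHu piau sP => [||f|g] u IHu piau sP.
- case: b piau sP => // _ sP; apply: all_pia_node => // i.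
  by apply/all_pia_or; split; [apply: all_pia_neg|];
    apply: IHu; [apply: (sP ord0)|apply: (sP ord_max)].
- case: b piau sP => // _ sP; apply: all_pia_node => // i.
  by apply/all_pia_and; split; [apply: all_pia_neg|];
    apply: IHu; [apply: (sP ord0)|apply: (sP ord_max)].
- apply: all_pia_node => // i; move: (sP i) => /=.
  by case: (fot i) => // ?; [|apply: all_pia_neg]; apply: IHu.
- apply: all_pia_node => // i; move: (sP i) => /=.
  by case: (got i) => // ?; [|apply: all_pia_neg]; apply: IHu.
Qed.

Lemma all_good_neg b t : all_good eps (~~ b, t) -> all_good eps (b, neg t).
Proof. by move=> tG; apply: all_good_node => //; case: b {tG}. Qed.

(** Only Skeleton roots need an argument: below any other root everything on a
    critical branch is PIA, and the translation preserves that. *)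
Lemma all_good_translate (s : term (bhae S)) b :
  all_good eps (b, s) -> all_good eps (b, translate s).
Proof.
elim: s b => [p||h|s IHs t IHt|s IHs t IHt|c u IHu] b /all_goodE sG.
1-3: by apply/all_pia_good/all_pia_translate/all_piaE => -[].
- by apply: all_good_node => //; apply: ord2P;
    [apply: IHs (sG ord0)|apply: IHt (sG ord_max)].
- by apply: all_good_node => //; apply: ord2P;
    [apply: IHs (sG ord0)|apply: IHt (sG ord_max)].
move: sG; case: ifPn => [skelu sG|_ ?]; last first.
  exact/all_pia_good/all_pia_translate.
case: c u IHu skelu sG => [||f|g] u IHu skelu sG.
- case: b skelu sG => // _ sG; apply: all_good_node => // i.
  apply: all_good_node => //.
  by apply: ord2P; [apply: all_good_neg|]; apply: IHu;
    [apply: (sG ord0)|apply: (sG ord_max)].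
- case: b skelu sG => // _ sG; apply: all_good_node => // i.
  apply: all_good_node => //.
  by apply: ord2P; [apply: all_good_neg|]; apply: IHu;
    [apply: (sG ord0)|apply: (sG ord_max)].
- apply: all_good_node => // i; move: (sG i) => /=.
  by case: (fot i) => // ?; [|apply: all_good_neg]; apply: IHu.
- apply: all_good_node => // i; move: (sG i) => /=.
  by case: (got i) => // ?; [|apply: all_good_neg]; apply: IHu.
Qed.

Variable Omega : rel nat.

Lemma siblings_var (L : lang) b p : @siblings L Omega eps (b, Var p).
Proof. by apply: siblings_node => [|[]//]; case: b. Qed.

Lemma siblings_neg b t :
  siblings Omega eps (~~ b, t) -> siblings Omega eps (b, neg t).
Proof. by move=> tS; apply: siblings_node => //; case: b {tS}. Qed.

Lemma siblings_box b t :
  siblings Omega eps (b, t) -> siblings Omega eps (b, box t).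
Proof. by move=> tS; apply: siblings_node => //; case: b {tS}. Qed.

Lemma siblings_dia b t :
  siblings Omega eps (b, t) -> siblings Omega eps (b, dia t).
Proof. by move=> tS; apply: siblings_node => //; case: b {tS}. Qed.

(** The nodes +Or and -And that come from implications and coimplications are
    SRR exactly when the original node is, and then have the same siblings. *)
Lemma siblings_translate (s : term (bhae S)) b :
  siblings Omega eps (b, s) -> siblings Omega eps (b, translate s).
Proof.
have siblings_bot (L : lang) b' : @siblings L Omega eps (b', Bot).
  by apply: siblings_node => [|[]//]; case: b'.
elim: s b => [p||h|s IHs t IHt|s IHs t IHt|c u IHu] b sS.
- rewrite /=; case: (eps p); [apply: siblings_box|apply: siblings_dia];
    exact: siblings_var.
- exact: siblings_bot.
- exact: siblings_neg.
- have /siblingsE[cS xS] := sS; apply/siblingsE; split.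
    by apply: ord2P; [apply: IHs (cS ord0)|apply: IHt (cS ord_max)].
  move=> sr i h lf lf' hi li c lh; apply: (xS _ i h) => //.
    apply/(leaf_translate (pair2 s t i)).
    by move: li; rewrite /= /pair2; case: ifP.
  apply/(leaf_translate (pair2 s t h)).
  by move: lh; rewrite /= /pair2; case: ifP.
- have /siblingsE[cS xS] := sS; apply/siblingsE; split.
    by apply: ord2P; [apply: IHs (cS ord0)|apply: IHt (cS ord_max)].
  move=> sr i h lf lf' hi li c lh; apply: (xS _ i h) => //.
    apply/(leaf_translate (pair2 s t i)).
    by move: li; rewrite /= /pair2; case: ifP.
  apply/(leaf_translate (pair2 s t h)).
  by move: lh; rewrite /= /pair2; case: ifP.
have /siblingsE[cS xS] := sS.
case: c u IHu sS cS xS => [||f|g] u IHu _ cS xS.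
- apply: siblings_box.
  have leaf_child i lf :
      leaf_of (b, pair2 (neg (translate (u ord0))) (translate (u ord_max)) i)
        lf ->
      leaf_of (@node_child _ (b, @Op (bhae S) Imp u) i) lf.
    by move: i; apply: ord2P => [/leaf_neg|]/leaf_translate.
  apply/siblingsE; split.
    by apply: ord2P; [apply: siblings_neg|]; apply: IHu;
      [apply: (cS ord0)|apply: (cS ord_max)].
  move=> sr i h lf lf' hi /leaf_child li c /leaf_child lh.
  have sr' : srr (b, @Op (bhae S) Imp u).
    by case: b sr {cS xS leaf_child i h hi li lh}.
  exact: (xS sr' i h lf lf' hi li c lh).
- apply: siblings_dia.
  have leaf_child i lf :
      leaf_of (b, pair2 (neg (translate (u ord0))) (translate (u ord_max)) i)
        lf ->
      leaf_of (@node_child _ (b, @Op (bhae S) Coimp u) i) lf.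
    by move: i; apply: ord2P => [/leaf_neg|]/leaf_translate.
  apply/siblingsE; split.
    by apply: ord2P; [apply: siblings_neg|]; apply: IHu;
      [apply: (cS ord0)|apply: (cS ord_max)].
  move=> sr i h lf lf' hi /leaf_child li c /leaf_child lh.
  have sr' : srr (b, @Op (bhae S) Coimp u).
    by case: b sr {cS xS leaf_child i h hi li lh}.
  exact: (xS sr' i h lf lf' hi li c lh).
- apply/siblingsE; split=> [i|sr i h lf lf' hi li c lh].
    move: (cS i) => /=.
    by case: (fot i) => // ?; [|apply: siblings_neg]; apply: IHu.
  apply: (xS _ i h) => //; move: li lh => /=.
    by case: (fot i) => [/leaf_translate|/leaf_neg/leaf_translate].
  by case: (fot h) => [_ /leaf_translate|_ /leaf_neg/leaf_translate].
- apply/siblingsE; split=> [i|sr i h lf lf' hi li c lh].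
    move: (cS i) => /=.
    by case: (got i) => // ?; [|apply: siblings_neg]; apply: IHu.
  apply: (xS _ i h) => //; move: li lh => /=.
    by case: (got i) => [/leaf_translate|/leaf_neg/leaf_translate].
  by case: (got h) => [_ /leaf_translate|_ /leaf_neg/leaf_translate].
Qed.

Lemma inductive_translate (s : term (bhae S)) b :
  inductive_tree Omega eps (b, s) -> inductive_tree Omega eps (b, translate s).
Proof.
rewrite !inductive_treeE => -[sG sS].
by split; [apply: all_good_translate|apply: siblings_translate].
Qed.

End Translation.

Local Open Scope order_scope.

(** * Prime filters of distributive lattices *)

Section PrimeFilters.
Context {d : Order.disp_t} (A : tbDistrLatticeType d).
Implicit Types (a b : A) (S T : set A) (s t : seq A).

Record pfilter := PFilter {
  mem :> A -> Prop;
  memT : mem \top;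
  mem0 : ~ mem \bot;
  memI : forall a b, mem (a `&` b) <-> mem a /\ mem b;
  memU : forall a b, mem (a `|` b) <-> mem a \/ mem b }.

Lemma mem_le (x : pfilter) a b : a <= b -> x a -> x b.
Proof. by move=> /meet_idPl <- /memI[]. Qed.

Lemma mem_meets (x : pfilter) s :
  x (\meet_(a <- s) a) <-> forall a, a \in s -> x a.
Proof.
elim: s => [|b s IHs]; first by rewrite big_nil; split=> // _; exact: memT.
rewrite big_cons memI IHs; split=> [[xb xs] a|xs].
  by rewrite inE => /orP[/eqP->|/xs].
by split=> [|a sa]; apply: xs; rewrite inE ?eqxx ?sa ?orbT.
Qed.

Lemma mem_joins (x : pfilter) s :
  x (\join_(a <- s) a) <-> exists2 a, a \in s & x a.
Proof.
elim: s => [|b s IHs]; first by rewrite big_nil; split=> [/mem0|[]].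
rewrite big_cons memU IHs; split=> [[xb|[a sa xa]]|[a]].
- by exists b => //; rewrite inE eqxx.
- by exists a => //; rewrite inE sa orbT.
- by rewrite inE => /orP[/eqP-> ?|sa xa]; [left|right; exists a].
Qed.

Lemma pfilter_inj (x y : pfilter) : (forall a, x a <-> y a) -> x = y.
Proof.
case: x y => [x xT x0 xI xU] [y yT y0 yI yU] /= xy.
have E : x = y by apply/funext => a; exact/propext.
case: y / E yT y0 yI yU {xy} => *.
by congr PFilter; exact: Prop_irrelevance.
Qed.

(** The conclusion of compactness, negated: in this form compactness becomes the
    existence of a prime filter that contains S and avoids T. *)
Definition separated S T := forall s t,
  (forall a, a \in s -> S a) -> (forall a, a \in t -> T a) ->
  ~ (\meet_(a <- s) a <= \join_(a <- t) a).

Definition adjoin S a : set A := fun b => S b \/ b = a.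

Lemma meets_adjoin S a s : (forall b, b \in s -> adjoin S a b) ->
  exists2 s', (forall b, b \in s' -> S b) &
    \meet_(b <- s') b `&` a <= \meet_(b <- s) b.
Proof.
elim: s => [|c s IHs] sS; first by exists [::] => //; rewrite !big_nil lex1.
have [b sb|s' s'S le_s's] := IHs; first by apply: sS; rewrite inE sb orbT.
have /sS[Sc|->] : c \in c :: s by rewrite inE eqxx.
- exists (c :: s') => [b|]; first by rewrite inE => /orP[/eqP->|/s'S].
  by rewrite !big_cons -meetA leI2.
- by exists s' => //; rewrite big_cons lexI le_s's leIr.
Qed.

Lemma not_separated_adjoin S T a : ~ separated (adjoin S a) T ->
  exists s t, [/\ forall b, b \in s -> S b, forall b, b \in t -> T b &
    \meet_(b <- s) b `&` a <= \join_(b <- t) b].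
Proof.
apply: contra_notP => N s t /meets_adjoin[s' s'S le_s's] tT le_st.
by apply: N; exists s', t; split=> //; apply: le_trans le_st.
Qed.

(** Zorn's lemma applies since a violation of separatedness is finite, hence
    occurs in one member of a chain. *)
Lemma maximal_separated S T : separated S T ->
  exists S', [/\ forall a, S a -> S' a, separated S' T &
    forall a, separated (adjoin S' a) T -> S' a].
Proof.
move=> sepST; pose P G := separated (S `|` G)%classic T.
have [F FP Ftot|G [PG Gmax]] := @Zorn_bigcup A P.
  move=> s t sF tT.
  suff [sS|[G FG sG]] : (forall a, a \in s -> S a) \/
      exists2 G, F G & forall a, a \in s -> (S `|` G)%classic a.
  - exact: sepST.
  - exact: FP FG _ _ sG tT.
  elim: s sF => [|b s IHs] sF; first by left.
  have /IHs[sS|[G FG sG]] : forall a, a \in s ->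
      (S `|` \bigcup_(X in F) X)%classic a.
  + by move=> a sa; apply: sF; rewrite inE sa orbT.
  + have /sF[Sb|[G FG Gb]] : b \in b :: s by rewrite inE eqxx.
      by left=> a; rewrite inE => /orP[/eqP->|/sS].
    by right; exists G => // a; rewrite inE => /orP[/eqP->|/sS]; [right|left].
  have /sF[Sb|[H FH Hb]] : b \in b :: s by rewrite inE eqxx.
    by right; exists G => // a; rewrite inE => /orP[/eqP->|/sG //]; left.
  right; have [GH|HG] := Ftot _ _ FG FH.
    exists H => // a; rewrite inE => /orP[/eqP->|/sG[|/GH]]; by [left|right].
  by exists G => // a; rewrite inE => /orP[/eqP->|/sG//]; right; exact: HG.
exists (S `|` G)%classic; split=> // [a|a sep_a]; first by left.
apply: contrapT => Ga; apply: (Gmax (G `|` [set a])%classic).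
  split; first by move=> b; left.
  by move=> /(_ a (or_intror erefl)) Ga'; apply: Ga; right.
move=> s t sS; apply: sep_a => b /sS[|[]]; by [left; left|left; right|right].
Qed.

(** A set that is maximal among those separated from T is a prime filter, since
    membership of a is equivalent to separatedness after adjoining a. *)
Theorem prime_separation S T : separated S T ->
  exists2 x : pfilter, (forall a, S a -> x a) & (forall a, T a -> ~ x a).
Proof.
move=> /maximal_separated[x [Sx sep_x xmax]].
have xle a b : x a -> a <= b -> x b.
  move=> xa le_ab; apply: xmax => s t /meets_adjoin[s' s'x le_s's] tT le_st.
  apply: (sep_x (a :: s') t) => // [c|].
    by rewrite inE => /orP[/eqP->|/s'x].
  rewrite big_cons meetC; apply: le_trans le_st; apply: le_trans le_s's.
  exact: leI2.
have xT : x \top.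
  apply: xmax => s t /meets_adjoin[s' s'x]; rewrite meetx1 => le_s's tT le_st.
  by apply: (sep_x s' t) => //; apply: le_trans le_st.
have xI a b : x a -> x b -> x (a `&` b).
  move=> xa xb; apply: xmax => s t /meets_adjoin[s' s'x le_s's] tT le_st.
  apply: (sep_x [:: a, b & s'] t) => // [c|].
    by rewrite !inE => /or3P[/eqP->|/eqP->|/s'x].
  by rewrite !big_cons meetA meetC; apply: le_trans le_st.
have x0 : ~ x \bot.
  move=> x0; apply: (sep_x [:: \bot] [::]) => // [a|].
    by rewrite inE => /eqP->.
  by rewrite big_seq1 big_nil.
have xU a b : x (a `|` b) -> x a \/ x b.
  move=> xab; apply: contrapT => /not_orP[xa xb].
  have [s [t [sx tT le_st]]] := not_separated_adjoin (fun H => xa (xmax a H)).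
  have [s' [t' [s'x t'T le_s't']]] :=
    not_separated_adjoin (fun H => xb (xmax b H)).
  apply: (sep_x [:: a `|` b & s ++ s'] (t ++ t')) => [c|c|].
  - by rewrite inE mem_cat => /or3P[/eqP->|/sx|/s'x].
  - by rewrite mem_cat => /orP[/tT|/t'T].
  rewrite big_cons !big_cat /= meetUl leU2 //.
    by apply: le_trans le_st; rewrite meetC leI2 // leIl.
  by apply: le_trans le_s't'; rewrite meetC leI2 // leIr.
have xIE a b : x (a `&` b) <-> x a /\ x b.
  split=> [xab|[]]; last exact: xI.
  by split; apply: xle xab _; rewrite ?leIl ?leIr.
have xUE a b : x (a `|` b) <-> x a \/ x b.
  by split=> [/xU//|[xa|xa]]; apply: xle xa _; rewrite ?leUl ?leUr.
exists (PFilter xT x0 xIE xUE) => // a Ta xa.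
apply: (sep_x [:: a] [:: a]) => [b|b|]; rewrite ?inE; first by move=> /eqP->.
  by move=> /eqP->.
by rewrite !big_seq1.
Qed.

Lemma pfilter_le a b : (forall x : pfilter, x a -> x b) -> a <= b.
Proof.
move=> ab; apply: contrapT => Nab.
have /prime_separation[x xa xb] : separated (eq^~ a) (eq^~ b).
  move=> s t sa tb le_st; apply: Nab.
  apply: (@le_trans _ _ (\meet_(c <- s) c)).
    by apply/meetsP_seq => c /sa ->.
  by apply: le_trans le_st _; apply/joinsP_seq => c /tb ->.
by apply: (xb b erefl); apply: ab; exact: xa.
Qed.

End PrimeFilters.

(** * Points of canonical extensions *)

Section CanonicalExtensionPoints.
Context {d d' : Order.disp_t} {L : tbLatticeType d} {C : tbLatticeType d'}.
Variable e : {lmorphism L -> C}.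
Hypothesis ce : canonical_extension e.
Implicit Types (a b : L).

Lemma supremums_Join (S : set C) : supremums S (Join S).
Proof.
rewrite /Join /supremum; case: ifPn => [/eqP->|_].
  by split=> [?|? _] //; exact: le0x.
by case: xgetP => // N; have [u /N] := ce_sup ce S.
Qed.

Lemma infimums_Meet (S : set C) : infimums S (Meet S).
Proof.
rewrite /Meet /infimum; case: ifPn => [/eqP->|_].
  by split=> [?|? _] //; exact: lex1.
by case: xgetP => // N; have [u /N] := ce_inf ce S.
Qed.

(** Closedness in a product is coordinatewise; the sets of approximants in the
    coordinates are combined into one set of tuples, which requires them to be
    nonempty, whence the added bounds. *)
Lemma eps_closedP n (eps : 'I_n -> bool) (k : 'I_n -> C) :
  eps_closed e eps k <->
  forall i, if eps i then closed_elt e (k i) else open_elt e (k i).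
Proof.
split=> [[S kS] i|kS].
  move: (kS i); rewrite image_comp.
  have -> : [set ((fun a : 'I_n -> C => a i) \o
      (fun a : 'I_n -> L => e \o a)) a | a in S]%classic =
      (e @` [set a i | a in S])%classic by rewrite image_comp.
  by case: (eps i) => ?; exists [set a i | a in S]%classic.
have {kS} /choice[T TP] i : exists T : set L,
    T (if eps i then \top else \bot) /\
    if eps i then infimums (e @` T)%classic (k i)
    else supremums (e @` T)%classic (k i).
  move: (kS i); case: (eps i) => -[T [Tlb Tglb]].
    exists (T `|` [set \top])%classic; split; first by right.
    split=> [_ [a [Ta|->] <-]|u ub].
    - by apply: Tlb; exact: imageP.
    - by rewrite (ce_top ce) lex1.
    - by apply: Tglb => _ [a Ta <-]; apply: ub; exists a => //; left.
  exists (T `|` [set \bot])%classic; split; first by right.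
  split=> [_ [a [Ta|->] <-]|u ub].
  - by apply: Tlb; exact: imageP.
  - by rewrite (ce_bot ce) le0x.
  - by apply: Tglb => _ [a Ta <-]; apply: ub; exists a => //; left.
exists [set a | forall i, T i (a i)]%classic => i.
suff -> : [set a i | a in [set e \o a | a in [set a | forall i, T i (a i)]]]%classic
    = (e @` T i)%classic by have [_] := TP i.
apply/seteqP; split=> [_ [_ [a Ta <-] <-]|_ [c Tc <-]].
  by exists (a i) => //; exact: Ta.
exists (e \o [eta (fun j => if eps j then \top else \bot) with i |-> c]);
  last first.
  by rewrite /= eqxx.
eexists; last by [].
by move=> j /=; case: eqP => [->//|_]; have [] := TP j.
Qed.

Lemma eps_openP n (eps : 'I_n -> bool) (o : 'I_n -> C) :
  eps_open e eps o <->
  forall i, if eps i then open_elt e (o i) else closed_elt e (o i).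
Proof.
have -> : eps_open e eps o = eps_closed e (fun i => ~~ eps i) o.
  apply/propext; split=> -[S oS]; exists S => i; move: (oS i); by case: (eps i).
by rewrite eps_closedP; split=> oP i; move: (oP i); case: (eps i).
Qed.

(** Two families of such predicates are used: membership of a point in a set of
    points, and being above the meet of a prime filter in any
    canonical extension.  Both give the membership conditions point_sigma and
    point_pi for the extended operations, so the two algebras are compared by
    comparing these conditions. *)
Record complete_point (P : C -> Prop) : Prop := CompletePoint {
  point_inf : forall S k, infimums S k -> P k <-> forall u, S u -> P u;
  point_sup : forall S o, supremums S o -> P o <-> exists2 u, S u & P u }.

Section Points.
Variables (P : C -> Prop) (pP : complete_point P).

Lemma point_closed (S : set L) k : infimums (e @` S)%classic k ->
  P k <-> forall a, S a -> P (e a).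
Proof.
move=> /(point_inf pP) ->; split=> [PS a Sa|PS _ [a Sa <-]]; last exact: PS.
by apply: PS; exact: imageP.
Qed.

Lemma point_open (S : set L) o : supremums (e @` S)%classic o ->
  P o <-> exists2 a, S a & P (e a).
Proof.
move=> /(point_sup pP) ->; split=> [[_ [a Sa <-]]|[a Sa Pa]]; first by exists a.
by exists (e a) => //; exact: imageP.
Qed.

Variables (n : nat) (eps : 'I_n -> bool) (h : ('I_n -> L) -> L).

Lemma point_sigma (u : 'I_n -> C) : P (sigma_ext e eps h u) <->
  exists k, [/\ eps_closed e eps k, eps_le eps k u &
    forall a : 'I_n -> L, eps_le eps k (e \o a) -> P (e (h a))].
Proof.
rewrite (point_sup pP (supremums_Join _)).
split=> [[_ [k [kK ku] <-]]|[k [kK ku Ph]]].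
  move=> /(point_inf pP (infimums_Meet _)) Ph; exists k; split=> // a ka.
  by apply: Ph; exists a.
exists (sigma_closed e eps h k); first by exists k.
by apply/(point_inf pP (infimums_Meet _)) => _ [a ka <-]; exact: Ph.
Qed.

Lemma point_pi (u : 'I_n -> C) : P (pi_ext e eps h u) <->
  forall o, eps_open e eps o -> eps_le eps u o ->
  exists2 a : 'I_n -> L, eps_le eps (e \o a) o & P (e (h a)).
Proof.
rewrite (point_inf pP (infimums_Meet _)).
split=> [Ph o oO uo|Ph _ [o [oO uo] <-]].
  have /(point_sup pP (supremums_Join _)) : P (pi_open e eps h o).
    by apply: Ph; exists o.
  by move=> [_ [a ao <-]]; exists a.
have [a ao Pa] := Ph o oO uo.
by apply/(point_sup pP (supremums_Join _)); exists (e (h a)) => //; exists a.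
Qed.

End Points.
End CanonicalExtensionPoints.

Section PrimePoints.
Context {d d' : Order.disp_t} {A : tbDistrLatticeType d} {C : tbLatticeType d'}.
Variable e : {lmorphism A -> C}.
Hypothesis ce : canonical_extension e.
Implicit Types (u w k o : C) (a b : A) (x : pfilter A).

Definition point_below x : C := Meet (e @` [set a | x a])%classic.
Definition point_above x : C := Join (e @` [set a | ~ x a])%classic.

Lemma point_below_emb x a : point_below x <= e a <-> x a.
Proof.
split=> [|xa]; last first.
  have [lb _] := infimums_Meet ce (e @` [set a | x a])%classic.
  by apply: lb; exact: imageP.
have a_sup : supremums (e @` [set a])%classic (e a).
  by split=> [_ [b -> <-]//|u]; apply; exact: imageP.
move=> /(ce_compact ce (infimums_Meet ce _) a_sup)[s [t [sx ta le_st]]].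
have /mem_joins[b /ta -> //] : x (\join_(b <- t) b).
by apply: mem_le le_st _; apply/mem_meets => b /sx.
Qed.

(** The elements point_below x and point_above x form a splitting pair: this is
    what makes point_below x completely join prime. *)
Lemma le_point_above x u : u <= point_above x <-> ~ (point_below x <= u).
Proof.
split=> [le_ua le_bu|Nxu].
  have := ce_compact ce (infimums_Meet ce _) (supremums_Join ce _)
    (le_trans le_bu le_ua).
  move=> [s [t [sx tx le_st]]].
  have /mem_joins[b /tx/[apply] //] : x (\join_(b <- t) b).
  by apply: mem_le le_st _; apply/mem_meets => b /sx.
have [T To [uT Tu]] := ce_meet_joins ce u.
have [o To' Nxo] : exists2 o, T o & ~ (point_below x <= o).
  by apply: contra_notP Nxu => /forall2NP N; apply: Tu => o /= To';
    have [//|/contrapT] := N o.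
apply: (le_trans (uT _ To')); have [S [So oS]] := To _ To'.
apply: oS => _ [a Sa <-].
have [ub _] := supremums_Join ce (e @` [set a | ~ x a])%classic.
apply: ub; apply: imageP => xa; apply: Nxo; apply: (@le_trans _ _ (e a)).
  exact/point_below_emb.
by apply: So; exact: imageP.
Qed.

Lemma prime_complete_point x : complete_point (fun u => point_below x <= u).
Proof.
split=> S u [Su uS]; split.
- by move=> xu w Sw; apply: le_trans xu (Su _ Sw).
- by move=> xS; apply: uS => w /xS.
- move=> xu; apply: contrapT => /forall2NP N.
  suff /le_point_above : u <= point_above x by [].
  by apply: uS => w Sw; apply/le_point_above; have [|] := N w.
- by move=> [w Sw xw]; apply: le_trans xw (Su _ Sw).
Qed.

Lemma le_emb_meets u (s : seq A) :
  (forall a, a \in s -> u <= e a) -> u <= e (\meet_(a <- s) a).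
Proof.
elim: s => [|a s IHs] us; first by rewrite big_nil (ce_top ce) lex1.
rewrite big_cons omorphI lexI us ?inE ?eqxx // IHs // => b sb.
by rewrite us // inE sb orbT.
Qed.

Lemma emb_joins_le u (s : seq A) :
  (forall a, a \in s -> e a <= u) -> e (\join_(a <- s) a) <= u.
Proof.
elim: s => [|a s IHs] us; first by rewrite big_nil (ce_bot ce) le0x.
rewrite big_cons omorphU leUx us ?inE ?eqxx // IHs // => b sb.
by rewrite us // inE sb orbT.
Qed.

(** If u is not below w, density gives a closed element below u that is not below
    an open element above w.  The sets of elements that define these two are
    separated, so a prime filter lies between them. *)
Lemma prime_points_le u w :
  (forall x, point_below x <= u -> point_below x <= w) -> u <= w.
Proof.
move=> uw; have [S Sk [Su uS]] := ce_join_meets ce u.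
have [T To [wT Tw]] := ce_meet_joins ce w.
apply: uS => k Sk'; apply: Tw => o To'.
have [K [kK Kk]] := Sk _ Sk'; have [O [Oo oO]] := To _ To'.
apply: contrapT => Nko.
have /prime_separation[x xK xO] : separated K O.
  move=> s t sK tO le_st; apply: Nko.
  apply: (@le_trans _ _ (e (\meet_(a <- s) a))).
    by apply: le_emb_meets => a /sK Ka; apply: kK; exact: imageP.
  apply: le_trans (omorph_le e le_st) _.
  by apply: emb_joins_le => a /tO Oa; apply: Oo; exact: imageP.
have xo : point_below x <= o.
  apply: (le_trans (uw x _)) (wT _ To'); apply: le_trans (Su _ Sk').
  by apply: Kk => _ [a Ka <-]; apply/point_below_emb; exact: xK.
have /(point_open (prime_complete_point x)) := conj Oo oO.
by move=> /iffLR/(_ xo)[a /xO xa /point_below_emb].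
Qed.

End PrimePoints.

(** * The free Boolean extension and its canonical extension *)

Section Booleanization.
Context {d : Order.disp_t} (A : tbDistrLatticeType d).
Local Open Scope classical_set_scope.
Implicit Types (U V : set (pfilter A)) (a b : A) (x y : pfilter A).

(** The sets hat a \ hat b form a base of the patch topology, for they are closed
    under finite intersections. *)
Definition patch_open U := forall x, U x ->
  exists a b, [/\ x a, ~ x b & forall y, y a -> ~ y b -> U y].

Definition patch_clopen U := patch_open U /\ patch_open (~` U).

Lemma patch_openI U V : patch_open U -> patch_open V -> patch_open (U `&` V).
Proof.
move=> oU oV x [/oU[a [b [xa xb ab]]] /oV[a' [b' [xa' xb' ab']]]].
exists (Order.meet a a'), (Order.join b b'); split; first by apply/memI.
  by move=> /memU[].
move=> y /memI[ya ya'] /memU/not_orP[yb yb'].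
by split; [apply: ab|apply: ab'].
Qed.

Lemma patch_openU U V : patch_open U -> patch_open V -> patch_open (U `|` V).
Proof.
move=> oU oV x [/oU|/oV] [a [b [xa xb ab]]]; exists a, b; split=> // y ya yb.
  by left; exact: ab.
by right; exact: ab.
Qed.

Lemma patch_clopenC U : patch_clopen U -> patch_clopen (~` U).
Proof. by move=> [oU oU']; split; rewrite ?setCK. Qed.

Lemma patch_clopenI U V :
  patch_clopen U -> patch_clopen V -> patch_clopen (U `&` V).
Proof.
move=> [oU oU'] [oV oV']; split; rewrite ?setCI.
  exact: patch_openI.
exact: patch_openU.
Qed.

Lemma patch_clopenT : patch_clopen setT.
Proof.
split=> [x _|x /(_ I)//].
by exists \top%O, \bot%O; split=> //; [exact: memT|exact: mem0].
Qed.

Record booleanization := Booleanization {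
  clopen_set :> set (pfilter A);
  _ : `[< patch_clopen clopen_set >] }.

Definition clopen_mem (U : booleanization) : pfilter A -> Prop := clopen_set U.
Coercion clopen_mem : booleanization >-> Funclass.

HB.instance Definition _ := [isSub for clopen_set].
HB.instance Definition _ := [Choice of booleanization by <:].

Let clopenI : meet_closed (fun U => `[< patch_clopen U >]).
Proof. by move=> U V /asboolP cU /asboolP cV; apply/asboolP/patch_clopenI. Qed.

Let clopenU : join_closed (fun U => `[< patch_clopen U >]).
Proof.
move=> U V /asboolP cU /asboolP cV; apply/asboolP.
rewrite joinEset -[U `|` V]setCK setCU.
by apply/patch_clopenC/patch_clopenI; exact: patch_clopenC.
Qed.

Let clopen0 : (\bot : set (pfilter A))%O \in (fun U => `[< patch_clopen U >]).
Proof.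
by apply/asboolP; rewrite botEset -setCT; exact/patch_clopenC/patch_clopenT.
Qed.

Let clopen1 : (\top : set (pfilter A))%O \in (fun U => `[< patch_clopen U >]).
Proof. exact/asboolP/patch_clopenT. Qed.

HB.instance Definition _ :=
  Order.SubChoice_isTBSubLattice.Build _ _ _ set_display booleanization
    clopenI clopenU clopen0 clopen1.

Let booleanization_meetUl :
  left_distributive (@Order.meet _ booleanization) (@Order.join _ booleanization).
Proof. by move=> U V W; apply: val_inj; exact: setIUl. Qed.

HB.instance Definition _ :=
  Order.Lattice_Meet_isDistrLattice.Build _ booleanization booleanization_meetUl.

Lemma booleanizationP (U : booleanization) : patch_clopen U.
Proof. by apply/asboolP; case: U. Qed.

Definition booleanizationC (U : booleanization) : booleanization :=
  Booleanization (asboolT (patch_clopenC (booleanizationP U))).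

Let joinxC (U : booleanization) : (U `|` booleanizationC U)%O = \top%O.
Proof. by apply: val_inj; exact: setUCr. Qed.

Let meetxC (U : booleanization) : (U `&` booleanizationC U)%O = \bot%O.
Proof. by apply: val_inj; exact: setICr. Qed.

HB.instance Definition _ :=
  Order.TBDistrLattice_hasComplement.Build _ booleanization joinxC meetxC.

HB.instance Definition _ :=
  Order.isOrderMorphism.Build _ _ _ _ clopen_set (fun _ _ UV => UV).
HB.instance Definition _ :=
  Order.isLatticeMorphism.Build _ _ _ _ clopen_set
    (fun _ _ => erefl) (fun _ _ => erefl).

Definition patch_emb : {lmorphism booleanization -> set (pfilter A)} :=
  [the {lmorphism _ -> _} of clopen_set].

Lemma booleanization_le (U V : booleanization) :
  (U <= V)%O <-> (forall x, U x -> V x).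
Proof. by split=> [/subsetPset//|UV]; apply/subsetPset. Qed.

Lemma patch_clopen_hat a : patch_clopen [set x | x a].
Proof.
split=> x xa; first by exists a, \bot%O; split=> //; exact: mem0.
by exists \top%O, a; split=> //; exact: memT.
Qed.

Definition hat a : booleanization :=
  Booleanization (asboolT (patch_clopen_hat a)).

Lemma supremums_bigcup (T : Type) (S : set (set T)) :
  supremums S (\bigcup_(U in S) U).
Proof.
split=> [U SU|U SU]; first by apply/subsetPset; exact: bigcup_sup.
by apply/subsetPset => x [V /SU /subsetPset]; exact.
Qed.

Lemma infimums_bigcap (T : Type) (S : set (set T)) :
  infimums S (\bigcap_(U in S) U).
Proof.
split=> [U SU|U SU]; first by apply/subsetPset; exact: bigcap_inf.
by apply/subsetPset => x Ux V /SU /subsetPset; exact.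
Qed.

Lemma set_complete_point (T : Type) (x : T) :
  complete_point (fun U : set T => U x).
Proof.
split=> S U SU.
  have -> := is_subset1_infimums SU (infimums_bigcap S).
  by split=> H V; exact: H.
have -> := is_subset1_supremums SU (supremums_bigcup S).
by split=> -[V SV Vx]; exists V.
Qed.

Lemma closed_set1 x : closed_elt patch_emb [set x].
Proof.
exists [set U : booleanization | U x].
suff -> : [set x] = \bigcap_(U in patch_emb @` [set U : booleanization | U x]) U.
  exact: infimums_bigcap.
apply/seteqP; split=> [_ -> _ [U Ux <-]//|y yx] /=.
apply: pfilter_inj => a; split=> [ya|xa]; last first.
  by apply: (yx (hat a)); exists (hat a).
apply: contrapT => xa; have := yx (~` hat a)%O.
by case=> //; exists (~` hat a)%O.
Qed.

Lemma patch_closedC U : closed_elt patch_emb U <-> open_elt patch_emb (~` U).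
Proof.
split=> -[S US].
  exists [set Order.compl V | V in S].
  suff -> : ~` U = \bigcup_(W in patch_emb @` [set Order.compl V | V in S]) W.
    exact: supremums_bigcup.
  rewrite (is_subset1_infimums US (infimums_bigcap _)); apply/seteqP; split=> x.
    move=> /existsNP[_ /not_implyP[[V SV <-] Vx]].
    by exists (~` V) => //; exists (Order.compl V) => //; exists V.
  move=> [_ [_ [V SV <-] <-] Vx] Sx; have NVx : ~ V x := Vx.
  by apply/NVx/(Sx (patch_emb V)); exists V.
exists [set Order.compl V | V in S].
suff -> : U = \bigcap_(W in patch_emb @` [set Order.compl V | V in S]) W.
  exact: infimums_bigcap.
rewrite -[LHS]setCK (is_subset1_supremums US (supremums_bigcup _)).
apply/seteqP; split=> x.
  move=> Sx _ [_ [V SV <-] <-]; suff : ~ V x by [].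
  by move=> Vx; apply: Sx; exists (patch_emb V) => //; exists V.
move=> Sx [_ [V SV <-] Vx]; apply: (Sx (patch_emb (Order.compl V))) => //.
by exists (Order.compl V) => //; exists V.
Qed.

Lemma open_setC1 x : open_elt patch_emb (~` [set x]).
Proof. exact/patch_closedC/closed_set1. Qed.

(** A prime filter of the Boolean extension is determined by its trace on A; the
    local bases of a clopen set and of its complement suffice to see this, so
    that compactness can be deduced from it. *)
Lemma ultrafilter_trace (y : pfilter booleanization) :
  exists x, forall U : booleanization, y U <-> U x.
Proof.
have xT : y (hat \top%O).
  suff -> : hat \top%O = \top%O by exact: memT.
  by apply/val_inj/seteqP; split=> // z _; exact: memT.
have x0 : ~ y (hat \bot%O).
  suff -> : hat \bot%O = \bot%O by exact: mem0.
  by apply/val_inj/seteqP; split=> // z /mem0.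
have xI a b : y (hat (a `&` b)%O) <-> y (hat a) /\ y (hat b).
  suff -> : hat (a `&` b)%O = (hat a `&` hat b)%O by exact: memI.
  by apply/val_inj/seteqP; split=> z /memI.
have xU a b : y (hat (a `|` b)%O) <-> y (hat a) \/ y (hat b).
  suff -> : hat (a `|` b)%O = (hat a `|` hat b)%O by exact: memU.
  by apply/val_inj/seteqP; split=> z /memU.
exists (PFilter xT x0 xI xU) => U; have [oU oU'] := booleanizationP U.
split=> [yU|/oU[a [b [/= xa xb ab]]]].
  apply: contrapT => /oU'[a [b [/= xa xb ab]]]; apply: xb.
  apply: (@mem_le _ _ y (U `&` hat a)%O); last exact/memI.
  apply/booleanization_le => z [Uz za]; apply: contrapT => zb.
  exact: (ab z).
have /memU[//|//] : y (hat b `|` U)%O.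
apply: mem_le xa; apply/booleanization_le => z za.
by have [zb|zb] := pselect (z b); [left|right; exact: ab].
Qed.

(** Compactness of the patch topology, from prime filters of the Boolean
    extension. *)
Lemma patch_compact (S T : set booleanization) : separated S T ->
  exists x, (forall U : booleanization, S U -> U x) /\
            (forall U : booleanization, T U -> ~ U x).
Proof.
move=> /prime_separation[y yS yT]; have [x xy] := ultrafilter_trace y.
by exists x; split=> U; [move=> /yS/xy|move=> /yT yU /xy].
Qed.

Theorem booleanization_canonical_extension : canonical_extension patch_emb.
Proof.
split.
- exact: val_inj.
- by [].
- by [].
- by move=> S; exists (\bigcup_(U in S) U); exact: supremums_bigcup.
- by move=> S; exists (\bigcap_(U in S) U); exact: infimums_bigcap.
- move=> U; exists [set [set x] | x in U] => [_ [x Ux <-]|].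
    exact: closed_set1.
  suff {2}-> : U = \bigcup_(V in [set [set x] | x in U]) V.
    exact: supremums_bigcup.
  apply/seteqP; split=> [x Ux|x [_ [y Uy <-] ->]//].
  by exists [set x] => //; exists x.
- move=> U; exists [set ~` [set x] | x in ~` U] => [_ [x Ux <-]|].
    exact: open_setC1.
  suff {2}-> : U = \bigcap_(V in [set ~` [set x] | x in ~` U]) V.
    exact: infimums_bigcap.
  apply/seteqP; split=> [x Ux _ [y Uy <-] xy|x xU].
    by apply: Uy; rewrite -xy.
  by apply: contrapT => Ux; apply: (xU (~` [set x])) => //; exists x.
move=> S T k o kS oT ko; apply: contrapT => N.
have /patch_compact[x [Sx Tx]] : separated S T.
  by move=> s t sS tT le_st; apply: N; exists s, t.
have kx : k x by apply/(point_closed (set_complete_point x) kS).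
have /subsetPset/(_ x kx) := ko.
by move=> /(point_open (set_complete_point x) oT)[U /Tx].
Qed.

End Booleanization.

Arguments patch_emb {d A}.

(** * The Boolean algebra with operators over a bi-Heyting algebra *)

Section Pointwise.
Context {d : Order.disp_t} {A : tbDistrLatticeType d}.
Implicit Types (a : A) (x : pfilter A) (U V : booleanization A).

Lemma hatE a x : hat a x = x a. Proof. by []. Qed.

Lemma booleanization_complE U x : (~` U) x = ~ U x. Proof. by []. Qed.

Lemma booleanization_meetE U V x : (U `&` V) x = (U x /\ V x).
Proof. by []. Qed.

Lemma booleanization_joinE U V x : (U `|` V) x = (U x \/ V x).
Proof. by []. Qed.

Definition pointE :=
  (hatE, booleanization_complE, booleanization_meetE, booleanization_joinE).

End Pointwise.

Section Hat.
Context {d : Order.disp_t} {A : tbDistrLatticeType d}.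
Implicit Types (a b c : A) (x y : pfilter A) (U V : booleanization A).

Lemma hat_le a b : (hat a <= hat b) = (a <= b).
Proof.
apply/idP/idP => [/booleanization_le ab|ab]; first exact: pfilter_le.
by apply/booleanization_le => x; exact: mem_le.
Qed.

Lemma hat_top : hat (\top : A) = \top.
Proof. by apply/val_inj/seteqP; split=> // x _; exact: memT. Qed.

Lemma hat_bot : hat (\bot : A) = \bot.
Proof. by apply/val_inj/seteqP; split=> // x /mem0. Qed.

Lemma hat_meet a b : hat (a `&` b) = hat a `&` hat b.
Proof. by apply/val_inj/seteqP; split=> x /memI. Qed.

Lemma hat_join a b : hat (a `|` b) = hat a `|` hat b.
Proof. by apply/val_inj/seteqP; split=> x /memU. Qed.

Lemma hat_meets (I : Type) (s : seq I) (F : I -> A) :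
  hat (\meet_(i <- s) F i) = \meet_(i <- s) hat (F i).
Proof.
by elim/big_rec2: _ => [|i U a _ <-]; [exact: hat_top|exact: hat_meet].
Qed.

Lemma hat_joins (I : Type) (s : seq I) (F : I -> A) :
  hat (\join_(i <- s) F i) = \join_(i <- s) hat (F i).
Proof.
by elim/big_rec2: _ => [|i U a _ <-]; [exact: hat_bot|exact: hat_join].
Qed.

(** By compactness: the basic sets inside U cover U. *)
Lemma clopen_joins U : exists2 s : seq (booleanization A),
  U = \join_(V <- s) V & forall V, V \in s -> exists a b, V = hat a `&` ~` hat b.
Proof.
pose T : set (booleanization A) :=
  (fun V => V <= U /\ exists a b, V = hat a `&` ~` hat b).
apply: contrapT => N; have /patch_compact[x [Ux Tx]] : separated (eq^~ U) T.
  move=> s t sU tT le_st; apply: N; exists t; last by move=> V /tT[].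
  apply/eqP; rewrite eq_le; apply/andP; split.
    by apply: le_trans le_st; apply/meetsP_seq => V /sU ->.
  by apply/joinsP_seq => V /tT[].
have [/(_ x (Ux _ erefl))[a [b [xa xb abU]]] _] := booleanizationP U.
apply: (Tx (hat a `&` ~` hat b)); last by split.
split; last by exists a, b.
by apply/booleanization_le => y [ya yb]; exact: abU.
Qed.

End Hat.

Lemma pair2_eta (T : Type) (u : 'I_2 -> T) : u = pair2 (u ord0) (u ord_max).
Proof. by apply/funext; apply: ord2P. Qed.

Section Adjoints.
Context {S : bhae_sig} {d : Order.disp_t} {A : tbDistrLatticeType d}.
Variable op : ops (bhae S) A.
Hypothesis alg : bhae_algebra op.
Implicit Types (a b c : A) (x y : pfilter A) (U V : booleanization A).

(** Left adjoints exist for finite joins if they exist for the joinands, and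
    hat a \ hat b lies below hat c iff a lies below b \/ c. *)
Lemma lower_adjoint_exists U : exists a, forall c, (U <= hat c) = (a <= c).
Proof.
have [s -> sE] := clopen_joins U.
elim: s sE => [|V s IHs] sE.
  by exists \bot => c; rewrite big_nil !le0x.
have [a aP] : exists a, forall c, (V <= hat c) = (a <= c).
  have [|a [b ->]] := sE V; first by rewrite inE eqxx.
  exists (@op Coimp (pair2 b a)) => c; rewrite (coimp_residual alg).
  rewrite -[RHS]hat_le hat_join.
  apply/idP/idP => /booleanization_le ab; apply/booleanization_le => x;
    have := ab x; rewrite !pointE; last by tauto.
  by have [] := pselect (x b); tauto.
have [W sW|a' a'P] := IHs; first by apply: sE; rewrite inE sW orbT.
by exists (a `|` a') => c; rewrite big_cons !leUx aP a'P.
Qed.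

(** Dually, hat c lies below the complement of hat a \ hat b iff a /\ c lies below
    b. *)
Lemma upper_adjoint_exists U : exists a, forall c, (hat c <= U) = (c <= a).
Proof.
have [s UE sE] := clopen_joins (~` U); rewrite -[U]complK UE compl_joins.
elim: s sE {U UE} => [|V s IHs] sE.
  by exists \top => c; rewrite big_nil !lex1.
have [a aP] : exists a, forall c, (hat c <= ~` V) = (c <= a).
  have [|a [b ->]] := sE V; first by rewrite inE eqxx.
  exists (@op Imp (pair2 a b)) => c; rewrite -(imp_residual alg).
  rewrite -[RHS]hat_le hat_meet.
  apply/idP/idP => /booleanization_le ab; apply/booleanization_le => x;
    have := ab x; rewrite !pointE; last by tauto.
  by have [] := pselect (x b); tauto.
have [W sW|a' a'P] := IHs; first by apply: sE; rewrite inE sW orbT.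
by exists (a `&` a') => c; rewrite big_cons !lexI aP a'P.
Qed.

Definition lower U : A := projT1 (cid (lower_adjoint_exists U)).
Definition upper U : A := projT1 (cid (upper_adjoint_exists U)).

Lemma lowerP U c : (U <= hat c) = (lower U <= c).
Proof. exact: projT2 (cid (lower_adjoint_exists U)) c. Qed.

Lemma upperP U c : (hat c <= U) = (c <= upper U).
Proof. exact: projT2 (cid (upper_adjoint_exists U)) c. Qed.

Lemma lower_hat a : lower (hat a) = a.
Proof. by apply/eqP; rewrite eq_le -lowerP lexx -hat_le lowerP lexx. Qed.

Lemma upper_hat a : upper (hat a) = a.
Proof. by apply/eqP; rewrite eq_le -upperP lexx -hat_le upperP lexx. Qed.

Lemma upperE U a : (forall c, (hat c <= U) = (c <= a)) -> upper U = a.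
Proof. by move=> aP; apply/eqP; rewrite eq_le -aP upperP lexx -upperP aP lexx. Qed.

Lemma lowerE U a : (forall c, (U <= hat c) = (a <= c)) -> lower U = a.
Proof. by move=> aP; apply/eqP; rewrite eq_le -aP lowerP lexx -lowerP aP lexx. Qed.

Lemma lower_joins (I : Type) (s : seq I) (F : I -> booleanization A) :
  lower (\join_(i <- s) F i) = \join_(i <- s) lower (F i).
Proof.
elim/big_rec2: _ => [|i a U _ <-]; apply: lowerE => c; first by rewrite !le0x.
by rewrite !leUx !lowerP.
Qed.

Lemma upper_meets (I : Type) (s : seq I) (F : I -> booleanization A) :
  upper (\meet_(i <- s) F i) = \meet_(i <- s) upper (F i).
Proof.
elim/big_rec2: _ => [|i a U _ <-]; apply: upperE => c; first by rewrite !lex1.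
by rewrite !lexI !upperP.
Qed.

Definition join_coord (b : bool) U : A := if b then lower U else upper (~` U).
Definition meet_coord (b : bool) U : A := if b then upper U else lower (~` U).

Definition bae_op : ops (bae S) (booleanization A) := fun k : conn (bae S) =>
  match k return
    ('I_(@arity (bae S) k) -> booleanization A) -> booleanization A
  with
  | Neg => fun u => ~` (u ord0)
  | DiaGe => fun u => hat (lower (u ord0))
  | BoxLe => fun u => hat (upper (u ord0))
  | Fo f => fun u => hat (@op (Fc f) (fun i => join_coord (fot i) (u i)))
  | Go g => fun u => hat (@op (Gc g) (fun i => meet_coord (got i) (u i)))
  end.

(** In a negative coordinate, complementation and upper turn joins into meets,
    which the operation on A turns back into joins. *)
Lemma hat_f_normal n (eps : 'I_n -> bool) (h : ('I_n -> A) -> A) :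
  f_normal eps h ->
  f_normal (fun=> true) (fun u => hat (h (fun i => join_coord (eps i) (u i)))).
Proof.
move=> hN u i s /=.
have etaE U : (fun j => join_coord (eps j) (if j == i then U else u j)) =
    [eta (fun j => join_coord (eps j) (u j)) with i |-> join_coord (eps i) U].
  by apply/funext => j /=; case: eqP => // ->.
 have hE U := congr1 (fun w => hat (h w)) (etaE U).
rewrite etaE (eq_bigr _ (fun U _ => hE U)).
rewrite -hat_joins; congr hat.
have := hN (fun j => join_coord (eps j) (u j)) i (map (join_coord (eps i)) s).
rewrite /join_coord; case: (eps i); rewrite !big_map; first by rewrite lower_joins.
by rewrite compl_joins upper_meets.
Qed.

Lemma hat_g_normal n (eps : 'I_n -> bool) (h : ('I_n -> A) -> A) :
  g_normal eps h ->
  g_normal (fun=> true) (fun u => hat (h (fun i => meet_coord (eps i) (u i)))).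
Proof.
move=> hN u i s /=.
have etaE U : (fun j => meet_coord (eps j) (if j == i then U else u j)) =
    [eta (fun j => meet_coord (eps j) (u j)) with i |-> meet_coord (eps i) U].
  by apply/funext => j /=; case: eqP => // ->.
have hE U := congr1 (fun w => hat (h w)) (etaE U).
rewrite etaE (eq_bigr _ (fun U _ => hE U)).
rewrite -hat_meets; congr hat.
have := hN (fun j => meet_coord (eps j) (u j)) i (map (meet_coord (eps i)) s).
rewrite /meet_coord; case: (eps i); rewrite !big_map; first by rewrite upper_meets.
by rewrite compl_meets lower_joins.
Qed.

Lemma booleanization_bae_algebra : bae_algebra bae_op.
Proof.
split=> //.
- by move=> u i s; rewrite /= (ord1 i) /= lower_joins hat_joins.
- by move=> u i s; rewrite /= (ord1 i) /= upper_meets hat_meets.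
- by move=> f; exact: (hat_f_normal (@bhae_f_normal _ _ _ _ alg f)).
- by move=> g; exact: (hat_g_normal (@bhae_g_normal _ _ _ _ alg g)).
Qed.

Section Translation.
Variable eps : nat -> bool.

(** Boxes and diamonds on the variables replace an arbitrary assignment on the
    Boolean algebra by one that comes from A. *)
Lemma eval_translate (v : nat -> booleanization A) (t : term (bhae S)) :
  eval bae_op v (translate eps t) =
  hat (eval op (fun p => if eps p then upper (v p) else lower (v p)) t).
Proof.
set w := fun p => _.
elim: t => [p|||s IHs t IHt|s IHs t IHt|[||f|g] u IHu] /=.
- by rewrite /w; case: (eps p).
- by rewrite hat_bot.
- by rewrite hat_top compl0.
- by rewrite IHs IHt hat_meet.
- by rewrite IHs IHt hat_join.
- rewrite !IHu [in RHS](pair2_eta (fun i => _)); congr hat; apply: upperE => c.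
  rewrite -(imp_residual alg) -[RHS]hat_le hat_meet.
  apply/idP/idP => /booleanization_le ab; apply/booleanization_le => x;
    have := ab x; rewrite !pointE; first by tauto.
  by have [] := pselect (x (eval op w (u ord0))); tauto.
- rewrite !IHu [in RHS](pair2_eta (fun i => _)); congr hat; apply: lowerE => c.
  rewrite (coimp_residual alg).
  rewrite -[RHS]hat_le hat_join.
  apply/idP/idP => /booleanization_le ab; apply/booleanization_le => x;
    have := ab x; rewrite !pointE; last by tauto.
  by have [] := pselect (x (eval op w (u ord0))); tauto.
- congr (hat (op _)); apply/funext => i; rewrite /join_coord.
  by case: (fot i); rewrite /= IHu ?complK ?lower_hat ?upper_hat.
- congr (hat (op _)); apply/funext => i; rewrite /meet_coord.
  by case: (got i); rewrite /= IHu ?complK ?lower_hat ?upper_hat.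
Qed.

Lemma valid_translate phi psi :
  valid op phi psi -> valid bae_op (translate eps phi) (translate eps psi).
Proof. by move=> phi_psi v; rewrite !eval_translate hat_le. Qed.

End Translation.
End Adjoints.

Arguments bae_op {S d A op} alg c.

(** * Extended operations on the powerset of the spectrum *)

Section ClosedSets.
Context {S : bhae_sig} {d : Order.disp_t} {A : tbDistrLatticeType d}.
Context {op : ops (bhae S) A}.
Variable alg : bhae_algebra op.
Local Open Scope classical_set_scope.
Implicit Types (x y : pfilter A) (U V : booleanization A).
Implicit Types (K W : set (pfilter A)).

Let bce := booleanization_canonical_extension A.

(** K meets the intersection of the complements of the sets hat a with a outside
    x, by compactness: otherwise some clopen U around K is covered by finitely
    many of these sets hat a, thus by one, and lower U would be below a. *)
Lemma closed_lower K x : closed_elt patch_emb K ->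
  (forall U, (K <= patch_emb U)%O -> x (lower alg U)) ->
  exists2 y, K y & forall a, y a -> x a.
Proof.
move=> [SK KE] Kx; pose T : set (booleanization A) :=
  (fun V => exists2 a, ~ x a & V = hat a).
have /patch_compact[y [Sy Ty]] : separated SK T.
  move=> s t sK tT le_st.
  have [a xa ta] : exists2 a, ~ x a & (\join_(V <- t) V <= hat a)%O.
    elim: t tT {le_st} => [|V t IHt] tT.
      by exists \bot%O; [exact: mem0|rewrite big_nil le0x].
    have [a xa ta] : exists2 a, ~ x a & (\join_(V <- t) V <= hat a)%O.
      by apply: IHt => W' tW; apply: tT; rewrite inE tW orbT.
    have [|b xb Vb] := tT V; first by rewrite inE eqxx.
    exists (b `|` a)%O; first by move=> /memU[].
    by rewrite big_cons hat_join Vb leU2.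
  apply: xa; apply: mem_le (Kx (\meet_(V <- s) V)%O _).
    by rewrite -(lowerP alg); exact: le_trans ta.
  apply: (le_emb_meets bce) => V /sK SV; have [lb _] := KE.
  by apply: lb; exists V.
exists y; first by apply/(point_closed (set_complete_point y) KE).
by move=> a ya; apply: contrapT => xa; apply: (Ty (hat a)) => //; exists a.
Qed.

(** The same argument with the sets hat a for a in x. *)
Lemma closed_upper K x : closed_elt patch_emb K ->
  (forall U, (K <= patch_emb U)%O -> ~ x (upper alg (~` U)%O)) ->
  exists2 y, K y & forall a, x a -> y a.
Proof.
move=> [SK KE] Kx; pose T : set (booleanization A) :=
  (fun V => exists2 a, x a & V = (~` hat a)%O).
have /patch_compact[y [Sy Ty]] : separated SK T.
  move=> s t sK tT le_st.
  have [a xa ta] : exists2 a, x a & (\join_(V <- t) V <= ~` hat a)%O.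
    elim: t tT {le_st} => [|V t IHt] tT.
      by exists \top%O; [exact: memT|rewrite big_nil le0x].
    have [a xa ta] : exists2 a, x a & (\join_(V <- t) V <= ~` hat a)%O.
      by apply: IHt => W' tW; apply: tT; rewrite inE tW orbT.
    have [|b xb Vb] := tT V; first by rewrite inE eqxx.
    exists (b `&` a)%O; first by apply/memI.
    by rewrite big_cons hat_meet complI Vb leU2.
  apply: (Kx (\meet_(V <- s) V)%O); last first.
    apply: mem_le xa; rewrite -(upperP alg) -leC complK; exact: le_trans ta.
  apply: (le_emb_meets bce) => V /sK SV; have [lb _] := KE.
  by apply: lb; exists V.
exists y; first by apply/(point_closed (set_complete_point y) KE).
by move=> a xa; apply: contrapT => ya; apply: (Ty (~` hat a)%O) => //; exists a.
Qed.

Lemma sigma_neg (W : 'I_1 -> set (pfilter A)) :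
  sigma_ext patch_emb (fun=> false) (bae_op alg Neg) W = ~` (W ord0).
Proof.
apply/seteqP; split=> x.
  move=> /(point_sigma bce (set_complete_point x)).
  move=> [k [/(eps_closedP bce) kO Wk kx] Wx].
  have kx' : k ord0 x by move: (Wk ord0) => /subsetPset; exact.
  have [T kT] := kO ord0.
  have [V TV Vx] := (point_open (set_complete_point x) kT).1 kx'.
  apply: (kx (fun=> V)) => // i; rewrite (ord1 i).
  by have [ub _] := kT; apply: ub; exists V.
move=> Wx; apply/(point_sigma bce (set_complete_point x)).
exists (fun=> ~` [set x]); split.
- by apply/(eps_closedP bce) => i; exact: open_setC1.
- move=> i; rewrite (ord1 i); apply/subsetPset => y Wy yx.
  by apply: Wx; rewrite -yx.
- move=> U /(_ ord0)/subsetPset Ux; suff : ~ U ord0 x by [].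
  by move=> Ux'; exact: (Ux x Ux').
Qed.

(** The extended modalities are those of the inclusion order of prime filters. *)
Lemma sigma_dia (W : 'I_1 -> set (pfilter A)) :
  sigma_ext patch_emb (fun=> true) (bae_op alg DiaGe) W =
  [set x | exists2 y, W ord0 y & forall a, y a -> x a].
Proof.
apply/seteqP; split=> x.
  move=> /(point_sigma bce (set_complete_point x)).
  move=> [k [/(eps_closedP bce) kK kW kx]].
  have [U kU|y ky yx] := closed_lower (x := x) (kK ord0).
    by apply: (kx (fun=> U)) => i; rewrite (ord1 i).
  by exists y => //; move: (kW ord0) => /subsetPset; exact.
move=> [y Wy yx]; apply/(point_sigma bce (set_complete_point x)).
exists (fun=> [set y]); split.
- by apply/(eps_closedP bce) => i; exact: closed_set1.
- by move=> i; rewrite (ord1 i); apply/subsetPset => _ ->.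
- move=> U /(_ ord0)/subsetPset/(_ y erefl) Uy; apply: yx.
  have /booleanization_le/(_ y Uy) // : (U ord0 <= hat (lower alg (U ord0)))%O.
  by rewrite (lowerP alg).
Qed.

Lemma pi_box (W : 'I_1 -> set (pfilter A)) :
  pi_ext patch_emb (fun=> true) (bae_op alg BoxLe) W =
  [set x | forall y, (forall a, x a -> y a) -> W ord0 y].
Proof.
apply/seteqP; split=> x.
  move=> /(point_pi bce (set_complete_point x)) xW y xy; apply: contrapT => Wy.
  have [||U UO Ux] := xW (fun=> ~` [set y]).
  - by apply/(eps_openP bce) => i; exact: open_setC1.
  - move=> i; rewrite (ord1 i); apply/subsetPset => z Wz zy.
    by apply: Wy; rewrite -zy.
  have /booleanization_le/(_ y (xy _ Ux)) Uy :
      (hat (upper alg (U ord0)) <= U ord0)%O.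
    by rewrite (upperP alg).
  by move: (UO ord0) => /subsetPset/(_ y Uy); exact.
move=> xW; apply/(point_pi bce (set_complete_point x)).
move=> o /(eps_openP bce) oO Wo.
apply: contrapT => /forall2NP N.
have [||y oy xy] := @closed_upper (~` o ord0) x.
- by apply/patch_closedC; rewrite setCK; exact: oO.
- move=> U /subsetPset oU xU; have [/=|] := N (fun=> (~` U)%O); last exact.
  apply=> i; rewrite (ord1 i); apply/subsetPset => z Uz; apply: contrapT => oz.
  exact: Uz (oU z oz).
by apply: oy; move: (Wo ord0) => /subsetPset; apply; exact: xW.
Qed.

End ClosedSets.

(** * Embedding the canonical extension of A into the powerset *)

Section Embedding.
Context {S : bhae_sig} {d d' : Order.disp_t}.
Context {A : tbDistrLatticeType d} {C : tbLatticeType d'}.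
Context {op : ops (bhae S) A}.
Variable alg : bhae_algebra op.
Variable e : {lmorphism A -> C}.
Hypothesis ce : canonical_extension e.
Local Open Scope classical_set_scope.
Implicit Types (x y : pfilter A) (a b : A) (U V : booleanization A).

Let bce := booleanization_canonical_extension A.
Let xP x := prime_complete_point ce x.
Let xbP x := set_complete_point x.

Definition extent (u : C) : set (pfilter A) :=
  [set x | (point_below e x <= u)%O].

Lemma extent_emb a x : extent (e a) x <-> x a.
Proof. exact: point_below_emb. Qed.

Lemma extent_le u w : (forall x, extent u x -> extent w x) <-> (u <= w)%O.
Proof.
split=> [|uw x]; first exact: prime_points_le.
by move=> xu; apply: le_trans uw.
Qed.

Lemma extent_up u x y : (forall a, x a -> y a) -> extent u x -> extent u y.
Proof.
move=> xy; apply: le_trans.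
have [_] := infimums_Meet ce (e @` [set a | x a]); apply => _ [a xa <-].
by apply/point_below_emb => //; exact: xy.
Qed.

Lemma extent_meet u w : extent (u `&` w)%O = extent u `&` extent w.
Proof.
apply/seteqP; split=> x; rewrite /extent /= lexI.
  by move=> /andP[].
by move=> [-> ->].
Qed.

Lemma extent_join u w : extent (u `|` w)%O = extent u `|` extent w.
Proof.
apply/seteqP; split=> x; last first.
  by case=> xu; apply: (le_trans xu); rewrite ?leUl ?leUr.
move=> xuw; apply: contrapT => /not_orP[].
move=> /(le_point_above ce) xu /(le_point_above ce) xw.
have /(le_point_above ce) // : (u `|` w <= point_above e x)%O.
by rewrite leUx xu xw.
Qed.

Lemma extent_bot : extent \bot%O = set0.
Proof.
apply/seteqP; split=> x //.
by have /(le_point_above ce) := le0x (point_above e x).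
Qed.

Lemma extent_top : extent \top%O = setT.
Proof. by apply/seteqP; split=> x // _; exact: lex1. Qed.

Lemma extent_closed k : closed_elt e k -> closed_elt patch_emb (extent k).
Proof.
move=> [T kT]; exists (@hat _ A @` T).
suff -> : extent k = \bigcap_(U in patch_emb @` (@hat _ A @` T)) U.
  exact: infimums_bigcap.
apply/seteqP; split=> x.
  move=> /(point_closed (xP x) kT) xT _ [_ [a Ta <-] <-].
  by apply/extent_emb; exact: xT.
move=> xT; apply/(point_closed (xP x) kT) => a Ta; apply/point_below_emb => //.
by apply: (xT (patch_emb (hat a))); do 2!apply: imageP.
Qed.

Lemma extent_open o : open_elt e o -> open_elt patch_emb (extent o).
Proof.
move=> [T oT]; exists (@hat _ A @` T).
suff -> : extent o = \bigcup_(U in patch_emb @` (@hat _ A @` T)) U.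
  exact: supremums_bigcup.
apply/seteqP; split=> x.
  move=> /(point_open (xP x) oT)[a Ta /extent_emb xa].
  by exists (patch_emb (hat a)) => //; do 2!apply: imageP.
move=> [_ [_ [a Ta <-] <-] xa]; apply/(point_open (xP x) oT).
by exists a => //; apply/extent_emb.
Qed.

Definition signed_extent (b : bool) (u : C) :=
  if b then extent u else ~` extent u.

(** The predicate H stands for membership of x in the values of an f-type
    operation, or for nonmembership in the values of a g-type operation, which
    gives both kinds of operations by one argument.  A closed tuple k of the
    canonical extension of A passes to the extents of its coordinates (or their
    complements); a closed tuple of sets passes to its best approximations. *)
Lemma sigma_transfer n (eps : 'I_n -> bool) (H : ('I_n -> A) -> Prop)
    (u : 'I_n -> C) :
  (exists k, [/\ eps_closed e eps k, eps_le eps k u &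
    forall a : 'I_n -> A, eps_le eps k (e \o a) -> H a]) <->
  (exists K, [/\ eps_closed patch_emb (fun=> true) K,
    eps_le (fun=> true) K (fun i => signed_extent (eps i) (u i)) &
    forall U : 'I_n -> booleanization A,
      eps_le (fun=> true) K (patch_emb \o U) ->
      H (fun i => join_coord alg (eps i) (U i))]).
Proof.
split=> -[k [kK ku Hk]].
  exists (fun i => signed_extent (eps i) (k i)); split.
  - apply/(eps_closedP bce) => i; have := (eps_closedP ce _ _).1 kK i.
    rewrite /signed_extent; case: (eps i) => [|/extent_open].
      exact: extent_closed.
    by rewrite (patch_closedC (~` _)) setCK.
  - move=> i; apply/subsetPset; move: (ku i); rewrite /signed_extent.
    by case: (eps i) => /extent_le kui // x kx /kui.
  move=> U kU; apply: Hk => i; move: (kU i) => /subsetPset.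
  rewrite /signed_extent /join_coord /=.
  case: (eps i) => kUi; apply/extent_le => x.
    move=> /kUi Ux; apply/extent_emb.
    have /booleanization_le/(_ x Ux) // : (U i <= hat (lower alg (U i)))%O.
    by rewrite (lowerP alg).
  move=> /extent_emb xU; apply: contrapT => /kUi Ux.
  have /booleanization_le/(_ x xU) : (hat (upper alg (~` U i)) <= ~` U i)%O.
    by rewrite (upperP alg).
  exact.
have kK' := (eps_closedP bce _ _).1 kK.
pose T i : set (booleanization A) := [set U | (k i <= patch_emb U)%O].
pose low i := [set lower alg U | U in T i].
pose upp i := [set upper alg (~` U)%O | U in T i].
pose m i := if eps i then Meet (e @` low i) else Join (e @` upp i).
have mP i x :
    if eps i then extent (m i) x <-> forall U, T i U -> x (lower alg U)
    else extent (m i) x <-> exists2 U, T i U & x (upper alg (~` U)%O).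
  rewrite /m; case: (eps i).
    rewrite /extent /= (point_closed (xP x) (infimums_Meet ce _)).
    split=> [xT U TU|xT _ [U TU <-]].
      by apply/(point_below_emb ce)/xT; exact: imageP.
    by apply/(point_below_emb ce)/xT.
  rewrite /extent /= (point_open (xP x) (supremums_Join ce _)).
  split=> [[_ [U TU <-] /(point_below_emb ce) xU]|[U TU xU]]; first by exists U.
  by exists (upper alg (~` U)%O); [exact: imageP|exact/(point_below_emb ce)].
exists m; split.
- apply/(eps_closedP ce) => i; rewrite /m; case: (eps i).
    by exists (low i); exact: (infimums_Meet ce).
  by exists (upp i); exact: (supremums_Join ce).
- move=> i; move: (ku i) (mP i) => /subsetPset; rewrite /signed_extent.
  case: (eps i) => kui mPi; apply/extent_le => x.
    move=> /mPi /(closed_lower (kK' i))[y /kui yu yx]; exact: extent_up yu.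
  move=> xu; apply/mPi; apply: contrapT => /forall2NP N.
  have [U kU|y /kui yu xy] := @closed_upper _ _ _ _ alg (k i) x (kK' i).
    by have [|] := N U.
  by apply: yu; exact: extent_up xu.
(* The clopen tuple of the sets hat (a i), complemented in the negative
   coordinates, contains k and returns a under join_coord. *)
move=> a ma; have -> : a = fun i => join_coord alg (eps i)
    (if eps i then hat (a i) else ~` hat (a i))%O.
  apply/funext => i; rewrite /join_coord.
  by case: (eps i); rewrite ?complK ?lower_hat ?upper_hat.
apply: (Hk (fun i => if eps i then hat (a i) else ~` hat (a i))%O) => i.
apply/subsetPset => y ky; move: (ma i) (mP i y) => /=.
case: (eps i) => /extent_le may mPy.
  apply/extent_emb/may/mPy => U kU.
  have /subsetPset/(_ y ky) Uy := kU.
  have /booleanization_le/(_ y Uy) // : (U <= hat (lower alg U))%O.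
  by rewrite (lowerP alg).
move=> /extent_emb/may/mPy[U /subsetPset/(_ y ky) Uy yU].
have /booleanization_le/(_ y yU) : (hat (upper alg (~` U)) <= ~` U)%O.
  by rewrite (upperP alg).
exact.
Qed.

Lemma extent_sigma n (eps : 'I_n -> bool) (f : ('I_n -> A) -> A) u :
  extent (sigma_ext e eps f u) =
  sigma_ext patch_emb (fun=> true)
    (fun W : 'I_n -> booleanization A =>
       hat (f (fun i => join_coord alg (eps i) (W i))))
    (fun i => signed_extent (eps i) (u i)).
Proof.
have H x := sigma_transfer eps (fun a : 'I_n -> A => x (f a)) u.
apply/seteqP; split=> x.
  move=> /(point_sigma ce (xP x))[k [kK ku kf]].
  apply/(point_sigma bce (xbP x))/H; exists k; split=> // a /kf.
  by move/(point_below_emb ce).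
move=> /(point_sigma bce (xbP x))/H[k [kK ku kf]].
apply/(point_sigma ce (xP x)); exists k; split=> // a /kf.
by move/(point_below_emb ce).
Qed.

(** Nonmembership in the values of g is the condition of sigma_transfer for the
    opposite order-type; on the Boolean side, the open and clopen tuples are
    the complements of those that occur there. *)
Lemma extent_pi n (eps : 'I_n -> bool) (g : ('I_n -> A) -> A) u :
  extent (pi_ext e eps g u) =
  pi_ext patch_emb (fun=> true)
    (fun W : 'I_n -> booleanization A =>
       hat (g (fun i => meet_coord alg (eps i) (W i))))
    (fun i => signed_extent (eps i) (u i)).
Proof.
have H x :=
  sigma_transfer (fun i => ~~ eps i) (fun a : 'I_n -> A => ~ x (g a)) u.
have flip_le (k w : 'I_n -> C) :
    eps_le (fun i => ~~ eps i) k w <-> eps_le eps w k.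
  by split=> kw i; move: (kw i); case: (eps i).
have flip_closed k : eps_closed e (fun i => ~~ eps i) k <-> eps_open e eps k.
  rewrite (eps_closedP ce) (eps_openP ce).
  by split=> ko i; move: (ko i); case: (eps i).
apply/seteqP; split=> x.
  move=> /(point_pi ce (xP x)) xg; apply/(point_pi bce (xbP x)) => o.
  move=> /(eps_openP bce) oO uo; apply: contrapT => /forall2NP N.
  have /H[k [/flip_closed kO /flip_le uk kg]] : exists K,
      [/\ eps_closed patch_emb (fun=> true) K,
      eps_le (fun=> true) K (fun i => signed_extent (~~ eps i) (u i)) &
      forall U : 'I_n -> booleanization A,
      eps_le (fun=> true) K (patch_emb \o U) ->
      ~ x (g (fun i => join_coord alg (~~ eps i) (U i)))].
    exists (fun i => ~` o i); split.
    - apply/(eps_closedP bce) => i; apply/patch_closedC.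
      by rewrite setCK; exact: oO.
    - move=> i; apply/subsetPset => y oy; move: (uo i) => /subsetPset.
      rewrite /signed_extent; case: (eps i) => uoi; first by move/uoi.
      by apply: contrapT => /uoi.
    move=> U oU; have [|] := N (fun i => ~` U i)%O.
      case=> i; apply/subsetPset => y Uy; apply: contrapT => oy.
      by move: (oU i) => /subsetPset/(_ y oy).
    rewrite /= /meet_coord /join_coord.
    suff -> : (fun i => if eps i then upper alg (~` U i)%O
                        else lower alg (~` ~` U i)%O) =
              (fun i => if ~~ eps i then lower alg (U i)
                        else upper alg (~` U i)%O) by [].
    by apply/funext => i; case: (eps i) => //=; rewrite complK.
  have [a /flip_le ka /(point_below_emb ce) xa] := xg _ kO uk.
  exact: (kg a).
move=> /(point_pi bce (xbP x)) xg; apply/(point_pi ce (xP x)) => o oO uo.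
apply: contrapT => /forall2NP N.
have /H[K [/(eps_closedP bce) Kcl Ku Kg]] : exists k,
    [/\ eps_closed e (fun i => ~~ eps i) k, eps_le (fun i => ~~ eps i) k u &
     forall a : 'I_n -> A, eps_le (fun i => ~~ eps i) k (e \o a) -> ~ x (g a)].
  exists o; split; [exact/flip_closed|exact/flip_le|move=> a /flip_le oa xa].
  by have [|] := N a; [exact|apply; apply/(point_below_emb ce)].
have [||U UK xU] := xg (fun i => ~` K i).
- by apply/(eps_openP bce) => i; apply/patch_closedC; exact: Kcl.
- move=> i; apply/subsetPset => y uy Ky.
  move: (Ku i) uy => /subsetPset/(_ y Ky).
  by rewrite /signed_extent; case: (eps i).
apply: (Kg (fun i => ~` U i)%O).
  move=> i; apply/subsetPset => y Ky; suff : ~ U i y by [].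
  by move=> Uy; move: (UK i) => /subsetPset/(_ y Uy); exact.
suff -> : (fun i => join_coord alg (~~ eps i) (~` U i)%O) =
          (fun i => meet_coord alg (eps i) (U i)) by [].
apply/funext => i; rewrite /join_coord /meet_coord.
by case: (eps i); rewrite //= complK.
Qed.

Lemma point_below_above x : (point_below e x <= point_above e x)%O = false.
Proof. by apply/negP; apply/(le_point_above ce). Qed.

(** If x is outside the extent on the left, the elements of x together
    with the elements above a closed approximation of the antecedent are
    separated from those below an open approximation of the consequent, and the
    prime filter in between refutes the right-hand side.  Conversely a
    prime filter y is approximated by the pair point_below y, point_above y. *)
Lemma extent_imp (u : 'I_2 -> C) :
  extent (pi_ext e (fun i => i == 1 :> nat) (@op Imp) u) =
  [set x | forall y, (forall a, x a -> y a) ->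
     extent (u ord0) y -> extent (u ord_max) y].
Proof.
apply/seteqP; split=> x.
  move=> /(point_pi ce (xP x)) xu y xy y0; apply: contrapT => y1.
  have [||a ay /(point_below_emb ce) /xy] :=
    xu (pair2 (point_below e y) (point_above e y)).
  - apply/(eps_openP ce); apply: ord2P => /=.
      by exists [set a | y a]; exact: (infimums_Meet ce).
    by exists [set a | ~ y a]; exact: (supremums_Join ce).
  - by apply: ord2P => //=; apply/(le_point_above ce).
  have /(point_below_emb ce) ya := ay ord0; have ya' := ay ord_max.
  rewrite (pair2_eta a) => yi.
  suff /(point_below_emb ce) : y (a ord_max).
    by move=> /le_trans/(_ ya'); rewrite point_below_above.
  by apply: mem_le ((memI y _ _).2 (conj ya yi)); rewrite (imp_residual alg).
move=> xu; apply/(point_pi ce (xP x)) => o /(eps_openP ce) oO uo.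
have [K oK] := oO ord0; have [T oT] := oO ord_max.
apply: contrapT => /forall2NP N.
have /prime_separation[y yS yT] :
    separated ([set a | x a] `|` [set a | (o ord0 <= e a)%O])
              [set a | (e a <= o ord_max)%O].
  move=> s t sS tT le_st.
  have [a [b [xa ob ab]]] : exists a b,
      [/\ x a, (o ord0 <= e b)%O & (a `&` b <= \meet_(c <- s) c)%O].
    elim: s sS {le_st} => [|c s IHs] sS.
      exists \top%O, \top%O; split; rewrite ?(ce_top ce) ?lex1 ?big_nil ?lex1 //.
      exact: memT.
    have [a [b [xa ob ab]]] : exists a b,
        [/\ x a, (o ord0 <= e b)%O & (a `&` b <= \meet_(c <- s) c)%O].
      by apply: IHs => c' sc'; apply: sS; rewrite inE sc' orbT.
    have [|xc|oc] := sS c; first by rewrite inE eqxx.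
      exists (c `&` a)%O, b; rewrite big_cons -meetA; split=> //.
        exact/memI.
      exact: leI2.
    exists a, (c `&` b)%O; rewrite big_cons meetCA; split=> //; last exact: leI2.
    by rewrite omorphI lexI; exact/andP.
  have ot := emb_joins_le ce tT.
  have [|] := N (pair2 b (\join_(c <- t) c)%O).
    by apply; apply: ord2P.
  apply; apply/(point_below_emb ce); apply: mem_le xa.
  by rewrite -(imp_residual alg) meetC; exact: le_trans le_st.
have y0 : extent (u ord0) y.
  apply: (@le_trans _ _ (o ord0)); last exact: (uo ord0).
  by apply/(point_closed (xP y) oK) => a Ka; apply/(point_below_emb ce)/yS; right;
    have [lb _] := oK; apply: lb; exact: imageP.
have /(xu y)/(_ y0) y1 : forall a, x a -> y a by move=> a xa; apply: yS; left.
have /extent_le/(_ y y1) := uo ord_max.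
move=> /(point_open (xP y) oT)[a Ta /(point_below_emb ce)].
by apply: yT; have [ub _] := oT; apply: ub; exact: imageP.
Qed.

Lemma extent_coimp (u : 'I_2 -> C) :
  extent (sigma_ext e (fun i => i == 1 :> nat) (@op Coimp) u) =
  [set x | exists y, [/\ forall a, y a -> x a,
     ~ extent (u ord0) y & extent (u ord_max) y]].
Proof.
apply/seteqP; split=> x; last first.
  move=> [y [yx y0 y1]]; apply/(point_sigma ce (xP x)).
  exists (pair2 (point_above e y) (point_below e y)); split.
  - apply/(eps_closedP ce); apply: ord2P => /=.
      by exists [set a | ~ y a]; exact: (supremums_Join ce).
    by exists [set a | y a]; exact: (infimums_Meet ce).
  - by apply: ord2P => //=; apply/(le_point_above ce).
  move=> a ya; apply/(point_below_emb ce)/yx; rewrite (pair2_eta a).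
  have ya0 := ya ord0; have /(point_below_emb ce) ya1 := ya ord_max.
  have : y (a ord0 `|` @op Coimp (pair2 (a ord0) (a ord_max)))%O.
    by apply: mem_le ya1; rewrite -(coimp_residual alg).
  move=> /memU[|//] /(point_below_emb ce) /le_trans /(_ ya0).
  by rewrite point_below_above.
move=> /(point_sigma ce (xP x))[k [/(eps_closedP ce) kK ku kx]].
have [O kO] := kK ord0; have [K kK'] := kK ord_max.
have /prime_separation[y yS yT] : separated [set a | (k ord_max <= e a)%O]
    ([set a | ~ x a] `|` [set a | (e a <= k ord0)%O]).
  move=> s t sS tT le_st.
  have [a [b [xa kb ab]]] : exists a b,
      [/\ ~ x a, (e b <= k ord0)%O & (\join_(c <- t) c <= b `|` a)%O].
    elim: t tT {le_st} => [|c t IHt] tT.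
      exists \bot%O, \bot%O; split; rewrite ?(ce_bot ce) ?le0x ?big_nil ?le0x //.
      exact: mem0.
    have [a [b [xa kb ab]]] : exists a b,
        [/\ ~ x a, (e b <= k ord0)%O & (\join_(c <- t) c <= b `|` a)%O].
      by apply: IHt => c' tc'; apply: tT; rewrite inE tc' orbT.
    have [|xc|kc] := tT c; first by rewrite inE eqxx.
      exists (c `|` a)%O, b; rewrite big_cons joinCA; split=> //.
        by move=> /memU[].
      exact: leU2.
    exists a, (c `|` b)%O; rewrite big_cons -joinA; split=> //; last exact: leU2.
    by rewrite omorphU leUx; exact/andP.
  have ks := le_emb_meets ce sS.
  have /(point_below_emb ce) := kx (pair2 b (\meet_(c <- s) c)%O) (ord2P kb ks).
  move=> xi; apply: xa; apply: mem_le xi.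
  by rewrite (coimp_residual alg); exact: le_trans ab.
exists y; split.
- by move=> a ya; apply: contrapT => xa; apply: (yT a) => //; left.
- move=> y0; have /extent_le/(_ y y0) := ku ord0.
  move=> /(point_open (xP y) kO)[a Oa /(point_below_emb ce)].
  by apply: yT; right; have [ub _] := kO; apply: ub; exact: imageP.
- apply: (@le_trans _ _ (k ord_max)); last exact: (ku ord_max).
  apply/(point_closed (xP y) kK') => a Ka; apply/(point_below_emb ce)/yS.
  by have [lb _] := kK'; apply: lb; exact: imageP.
Qed.

Section Evaluation.
Variable eps : nat -> bool.

Local Notation eval_set := (eval (delta_ops patch_emb (bae_op alg))).

Lemma eval_neg (w : nat -> set (pfilter A)) t :
  eval_set w (neg t) = ~` eval_set w t.
Proof. exact: sigma_neg. Qed.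

Lemma eval_box (w : nat -> set (pfilter A)) t :
  eval_set w (box t) =
  [set x | forall y, (forall a, x a -> y a) -> eval_set w t y].
Proof. exact: pi_box. Qed.

Lemma eval_dia (w : nat -> set (pfilter A)) t :
  eval_set w (dia t) =
  [set x | exists2 y, eval_set w t y & forall a, y a -> x a].
Proof. exact: sigma_dia. Qed.

Lemma eval_imp (w : nat -> set (pfilter A)) s t :
  eval_set w (box (Or (neg s) t)) =
  [set x | forall y, (forall a, x a -> y a) ->
     eval_set w s y -> eval_set w t y].
Proof.
have E : eval_set w (Or (neg s) t) = ~` eval_set w s `|` eval_set w t.
  by rewrite -eval_neg.
rewrite eval_box E; apply/seteqP; split=> x xst y /xst; first by case.
by have [sy|sy] := pselect (eval_set w s y); [right; auto|left].
Qed.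

Lemma eval_coimp (w : nat -> set (pfilter A)) s t :
  eval_set w (dia (And (neg s) t)) =
  [set x | exists y, [/\ forall a, y a -> x a,
     ~ eval_set w s y & eval_set w t y]].
Proof.
have E : eval_set w (And (neg s) t) = ~` eval_set w s `&` eval_set w t.
  by rewrite -eval_neg.
rewrite eval_dia E; apply/seteqP; split=> x [y].
  by move=> [sy ty] yx; exists y.
by move=> [yx sy ty]; exists y.
Qed.

Lemma eval_signed (w : nat -> set (pfilter A)) (b : bool) t :
  eval_set w (if b then t else neg t) =
  if b then eval_set w t else ~` eval_set w t.
Proof. by case: b => //; exact: eval_neg. Qed.

(** On the canonical extensions no assignment has to be changed: extents are
    up-sets, which the extended modalities fix. *)
Lemma eval_translate_delta (v : nat -> C) (t : term (bhae S)) :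
  eval_set (fun p => extent (v p)) (translate eps t) =
  extent (eval (delta_ops e op) v t).
Proof.
elim: t => [p||h|s IHs t IHt|s IHs t IHt|[||f|g] u IHu].
- rewrite /=; case: (eps p).
    rewrite eval_box; apply/seteqP; split=> x /= xv; first exact: xv.
    by move=> y xy; apply: extent_up xv.
  rewrite eval_dia; apply/seteqP; split=> x /= xv; last by exists x.
  by move: xv => [y yv yx]; apply: extent_up yv.
- by rewrite /= extent_bot.
- by rewrite eval_neg /= extent_top -setC0.
- by rewrite /= IHs IHt extent_meet.
- by rewrite /= IHs IHt extent_join.
- by rewrite [RHS]extent_imp -!IHu -eval_imp.
- by rewrite [RHS]extent_coimp -!IHu -eval_coimp.
- transitivity (sigma_ext patch_emb (fun=> true) (bae_op alg (Fo f))
    (fun i => eval_set (fun p => extent (v p))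
       (if fot i then translate eps (u i) else neg (translate eps (u i))))) => //.
  rewrite [RHS]extent_sigma; congr sigma_ext; apply/funext => i.
  by rewrite eval_signed IHu.
- transitivity (pi_ext patch_emb (fun=> true) (bae_op alg (Go g))
    (fun i => eval_set (fun p => extent (v p))
       (if got i then translate eps (u i) else neg (translate eps (u i))))) => //.
  rewrite [RHS]extent_pi; congr pi_ext; apply/funext => i.
  by rewrite eval_signed IHu.
Qed.

End Evaluation.

End Embedding.

Theorem theorem7p1 (S : bhae_sig) :
  (forall alpha beta : term (bae S), inductive_ineq alpha beta ->
     forall (d : Order.disp_t) (B : ctbDistrLatticeType d) (op : ops (bae S) B),
       bae_algebra op -> valid op alpha beta ->
     forall (d' : Order.disp_t) (Bd : tbLatticeType d')
            (e : {lmorphism B -> Bd}),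
       canonical_extension e -> valid (delta_ops e op) alpha beta) ->
  forall phi psi : term (bhae S), inductive_ineq phi psi ->
     forall (d : Order.disp_t) (A : tbDistrLatticeType d) (op : ops (bhae S) A),
       bhae_algebra op -> valid op phi psi ->
     forall (d' : Order.disp_t) (Ad : tbLatticeType d')
            (e : {lmorphism A -> Ad}),
       canonical_extension e -> valid (delta_ops e op) phi psi.
Proof.
move=> bae_canonical phi psi [Omega [eps [Oirr Otr phiI psiI]]].
move=> d A op alg phi_psi d' Ad e ce v.
have trI : inductive_ineq (translate eps phi) (translate eps psi).
  by exists Omega, eps; split=> //; exact: inductive_translate.
have := bae_canonical _ _ trI _ _ _ (booleanization_bae_algebra alg)
  (valid_translate alg eps phi_psi) _ _ _
  (booleanization_canonical_extension A) (fun p => extent e (v p)).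
move=> /subsetPset; rewrite !(eval_translate_delta alg ce) => phi_psi_set.
exact/(extent_le ce).
Qed.
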